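(* Let $i\in\mathbb{N}_0$ and let $\alpha,\beta\in\mathbb{C}$. Then $$F^{1:1;2}_{1:0;1}\left[\begin{matrix}\alpha: & \beta-2-i\,; & 2+i,\ \tfrac12\alpha+1\,;\\ \beta: & -\,; & \tfrac12\alpha\,;\end{matrix}\ -1,\ -1\right] =\frac{2^{-2-\alpha}\,\Gamma\!\left(\tfrac12\beta\right)}{(i+1)!\,\Gamma\!\left(\tfrac12\beta-i-2\right)}\sum_{r=0}^{i}(-1)^r\binom{i}{r}\frac{\Gamma\!\left(\frac14\beta-1+\frac{r-i}{2}\right)}{\Gamma\!\left(\frac14\beta+1+\frac{r-i}{2}\right)}$$ and $$F^{1:1;2}_{1:0;1}\left[\begin{matrix}\alpha: & \beta-2+i\,; & 2-i,\ \tfrac12\alpha+1\,;\\ \beta: & -\,; & \tfrac12\alpha\,;\end{matrix}\ -1,\ -1\right] =\frac{2^{-2-\alpha}\,\Gamma\!\left(\tfrac12\beta\right)}{\Gamma\!\left(\tfrac12\beta+i-2\right)}\sum_{r=0}^{i}\binom{i}{r}\frac{\Gamma\!\left(\frac14\beta-1+\frac{r+i}{2}\right)}{\Gamma\!\left(\frac14\beta+1+\frac{r-i}{2}\right)}.$$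
   Context: For $\lambda\in\mathbb{C}$ and $n\in\mathbb{N}_0$, $(\lambda)_0=1$ and $(\lambda)_n=\lambda(\lambda+1)\cdots(\lambda+n-1)$; $\Gamma$ is Euler's Gamma function and $\binom{i}{r}$ the binomial coefficient. The (generalized) Kampé de Fériet function is defined by $$F^{H:A;B}_{G:C;D}\left[\begin{matrix}(h_H): & (a_A)\,; & (b_B)\,;\\ (g_G): & (c_C)\,; & (d_D)\,;\end{matrix}\ x,\ y\right]=\sum_{m=0}^\infty\sum_{n=0}^\infty\frac{\prod_{j=1}^H(h_j)_{m+n}\prod_{j=1}^A(a_j)_m\prod_{j=1}^B(b_j)_n}{\prod_{j=1}^G(g_j)_{m+n}\prod_{j=1}^C(c_j)_m\prod_{j=1}^D(d_j)_n}\frac{x^m}{m!}\frac{y^n}{n!},$$ where a dash ''$-$'' denotes an empty list of parameters (empty products equal $1$). Parameters are tacitly assumed to be such that the double series converges, no denominator parameter is a non-positive integer, and all Gamma values appearing are finite. *)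

(* Defs.v *)
From Stdlib Require Import Reals List Factorial.
From Coquelicot Require Import Coquelicot.
Import ListNotations.
Open Scope R_scope.

Fixpoint cpown (z : C) (n : nat) : C :=
  match n with O => RtoC 1 | S k => Cmult (cpown z k) z end.

Fixpoint poch (l : C) (n : nat) : C :=
  match n with O => RtoC 1 | S k => Cmult (poch l k) (Cplus l (RtoC (INR k))) end.

Definition prodl (ps : list C) (f : C -> C) : C :=
  fold_right (fun p acc => Cmult (f p) acc) (RtoC 1) ps.

Definition kdf_term (h a b g c d : list C) (x y : C) (m n : nat) : C :=
  Cmult
   (Cdiv (Cmult (Cmult (prodl h (fun p => poch p (m + n)))
                       (prodl a (fun p => poch p m)))
                (prodl b (fun p => poch p n)))
         (Cmult (Cmult (prodl g (fun p => poch p (m + n)))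
                       (prodl c (fun p => poch p m)))
                (prodl d (fun p => poch p n))))
   (Cmult (Cdiv (cpown x m) (RtoC (INR (fact m))))
          (Cdiv (cpown y n) (RtoC (INR (fact n))))).

Definition kdf_partial (h a b g c d : list C) (x y : C) (M N : nat) : C :=
  sum_n (fun m => sum_n (fun n => kdf_term h a b g c d x y m n) N) M.

(* The double series converges (in Pringsheim's sense: M, N -> oo
   independently) and its sum is L. *)
Definition kdf_sum_is (h a b g c d : list C) (x y : C) (L : C) : Prop :=
  filterlim (fun p : nat * nat => kdf_partial h a b g c d x y (fst p) (snd p))
            (filter_prod eventually eventually) (locally L).

(* a^z for real a > 0 and complex z : exp(z ln a) *)
Definition cpow_pos (a : R) (z : C) : C :=
  (exp (Re z * ln a) * cos (Im z * ln a), exp (Re z * ln a) * sin (Im z * ln a)).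

(* Euler's Gamma function on C, via the Euler-Gauss limit
   Gamma(z) = lim_n n! n^z / (z (z+1) ... (z+n)),  valid for z not in -N_0 *)
Definition euler_gamma_seq (z : C) (n : nat) : C :=
  Cdiv (Cmult (RtoC (INR (fact n))) (cpow_pos (INR n) z)) (poch z (S n)).

Definition CGamma (z : C) : C :=
  (real (Lim_seq (fun n => Re (euler_gamma_seq z n))),
   real (Lim_seq (fun n => Im (euler_gamma_seq z n)))).

Definition not_npint (z : C) : Prop := forall k : nat, z <> RtoC (- INR k).

(* Main.v *)
(** Write [b] for [2 + i] or [2 - i] and [a = beta - b]. By Vandermonde the sum of the
    terms on the antidiagonal [m + n = N] is
    [(-1)^N (alpha)_N / N! * (1 + 2 b N / (alpha beta))], the coefficient of [x^N] in
    [(1 + x)^(-alpha) (1 - (2 b / beta) x / (1 + x))]; at [x = 1] this is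
    [2^(-alpha) a / beta].

    The double series need not converge absolutely, so rearranging needs an argument.
    Pringsheim convergence bounds the corner of the array of partial sums; since the
    terms of a row (or column) are hypergeometric with ratio tending to [-1], every row
    and column of partial sums is [o(n)]. Hence the antidiagonal averages of the partial
    sums tend to [L]. These averages are the Cesaro means of the series of antidiagonal
    sums, which is therefore Abel summable to [L].

    The Gamma sums reduce to rational identities by [Gamma (z + 1) = z Gamma z]: partial
    fractions for the first one, and [(1 + E)^(k+1)] applied to
    [((x + r - k) / 2)_k], with [E] the shift of [r], for the second one. *)

Require Import Defs.
From Stdlib Require Import Reals List Factorial Lra Lia.
From Coquelicot Require Import Coquelicot.
Import ListNotations.

Local Open Scope C_scope.

(** * Finite sums *)

(** Convergence in Pringsheim's sense says nothing about a single row or column, so their growth has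
    to be extracted from the corner bound alone. All rows are asymptotically multiples of row 0;
    hence one step in [n] changes the partial sum of [m] rows by a term of row 0 times nearly
    [sum_{i<m} (-1)^i A_i]. If that alternating sum is nonzero for some large [m], row 0 is bounded.
    For the columns, the corresponding sums can vanish from some point on only if [alpha = -q], and
    then the columns terminate. [CGamma] is built from [Lim_seq], which has a value even where there
    is no limit; so the Euler-Gauss sequence is first shown to converge to a nonzero number, and
    only then is the functional equation derived. Both finite Gamma expressions turn out to be
    [4 a / beta]; the 4 is what the factor [2^(-2)] cancels. *)

Fixpoint csum (f : nat -> C) (n : nat) : C :=
  match n with O => 0 | S k => csum f k + f k end.

Lemma sum_n_csum (f : nat -> C) n : sum_n f n = csum f (S n).
Proof.
induction n as [|n IH].
- rewrite sum_O; simpl; ring.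
- rewrite sum_Sn, IH; reflexivity.
Qed.

Lemma csum_ext f g n :
  (forall k, (k < n)%nat -> f k = g k) -> csum f n = csum g n.
Proof.
induction n as [|n IH]; simpl; intros H; [reflexivity|].
rewrite IH, (H n); auto.
Qed.

Lemma csum_plus f g n : csum (fun k => f k + g k) n = csum f n + csum g n.
Proof. induction n as [|n IH]; simpl; [|rewrite IH]; ring. Qed.

Lemma csum_scal c f n : csum (fun k => c * f k) n = c * csum f n.
Proof. induction n as [|n IH]; simpl; [|rewrite IH]; ring. Qed.

Lemma csum_S_l f n : csum f (S n) = f O + csum (fun k => f (S k)) n.
Proof.
induction n as [|n IH]; [simpl; ring|].
change (csum f (S (S n))) with (csum f (S n) + f (S n)).
rewrite IH; simpl; ring.
Qed.

Lemma csum_exchange (f : nat -> nat -> C) m n :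
  csum (fun i => csum (fun j => f i j) n) m
  = csum (fun j => csum (fun i => f i j) m) n.
Proof.
induction m as [|m IH]; simpl.
- induction n as [|n IHn]; simpl; [|rewrite <- IHn; ring]; reflexivity.
- rewrite IH, <- csum_plus; reflexivity.
Qed.

(* [diag f N] is the sum of [f i j] over [i + j = N]. *)
Fixpoint diag (f : nat -> nat -> C) (N : nat) : C :=
  match N with
  | O => f O O
  | S N => f O (S N) + diag (fun i j => f (S i) j) N
  end.

Lemma diag_S_r f N : diag f (S N) = diag (fun i j => f i (S j)) N + f (S N) O.
Proof.
revert f; induction N as [|N IH]; intros f; [simpl; ring|].
change (diag f (S (S N))) with (f O (S (S N)) + diag (fun i j => f (S i) j) (S N)).
rewrite IH; simpl; ring.
Qed.

Lemma diag_ext f g N :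
  (forall i j, (i + j = N)%nat -> f i j = g i j) -> diag f N = diag g N.
Proof.
revert f g; induction N as [|N IH]; intros f g H; simpl.
- apply H; reflexivity.
- rewrite (H O (S N)) by reflexivity; f_equal; apply IH; intros i j <-.
  apply H; reflexivity.
Qed.

Lemma diag_plus f g N : diag (fun i j => f i j + g i j) N = diag f N + diag g N.
Proof.
revert f g; induction N as [|N IH]; intros f g; simpl; [ring|].
rewrite (IH (fun i j => f (S i) j) (fun i j => g (S i) j)); ring.
Qed.

Lemma diag_scal c f N : diag (fun i j => c * f i j) N = c * diag f N.
Proof.
revert f; induction N as [|N IH]; intros f; simpl; [ring|].
rewrite (IH (fun i j => f (S i) j)); ring.
Qed.

(** * Rising factorials and the Vandermonde convolution *)

Lemma RtoC_S n : RtoC (INR (S n)) = RtoC (INR n) + 1.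
Proof. rewrite S_INR, RtoC_plus; reflexivity. Qed.

Lemma RtoC_INR_plus m n : RtoC (INR (m + n)) = RtoC (INR m) + RtoC (INR n).
Proof. rewrite plus_INR, RtoC_plus; reflexivity. Qed.

Lemma RtoC_neq_0 x : x <> 0%R -> RtoC x <> 0.
Proof. intros H E; apply H; injection E; auto. Qed.

Lemma S_neq_0 n : RtoC (INR n) + 1 <> 0.
Proof. rewrite <- RtoC_S; apply RtoC_neq_0, not_0_INR; discriminate. Qed.

Lemma fact_neq_0C n : RtoC (INR (fact n)) <> 0.
Proof. apply RtoC_neq_0, INR_fact_neq_0. Qed.

Lemma fact_S_C n :
  RtoC (INR (fact (S n))) = (RtoC (INR n) + 1) * RtoC (INR (fact n)).
Proof. rewrite fact_simpl, mult_INR, RtoC_mult, RtoC_S; reflexivity. Qed.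

Lemma Cmult_integral (a b : C) : a * b = 0 -> a = 0 \/ b = 0.
Proof.
intros H; destruct (Ceq_dec a 0) as [|Ha]; [auto|right].
destruct (Ceq_dec b 0) as [|Hb]; [auto|].
destruct (Cmult_neq_0 _ _ Ha Hb H).
Qed.

(** The coefficient of [x^n] in [(1 - x)^(-a)]; [pdiv_S] is the differential equation
    [(1 - x) f' = a f] read coefficientwise. *)
Definition pdiv (a : C) (n : nat) : C := poch a n / RtoC (INR (fact n)).

Lemma pdiv_0 a : pdiv a 0 = 1.
Proof. unfold pdiv; simpl; field. Qed.

Lemma pdiv_S a n :
  (RtoC (INR n) + 1) * pdiv a (S n) = (a + RtoC (INR n)) * pdiv a n.
Proof.
unfold pdiv; rewrite fact_S_C; simpl; field.
split; [apply fact_neq_0C | apply S_neq_0].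
Qed.

Lemma poch_S_l a n : poch a (S n) = a * poch (a + 1) n.
Proof.
induction n as [|n IH]; [simpl; ring|].
change (poch a (S (S n))) with (poch a (S n) * (a + RtoC (INR (S n)))).
rewrite IH, RtoC_S; simpl; ring.
Qed.

Lemma poch_add a m n : poch a (m + n) = poch a n * poch (a + RtoC (INR n)) m.
Proof.
induction m as [|m IH]; simpl; [ring|].
rewrite IH, RtoC_INR_plus; ring.
Qed.

Lemma poch_neq_0 a n :
  (forall k, (k < n)%nat -> a + RtoC (INR k) <> 0) -> poch a n <> 0.
Proof.
induction n as [|n IH]; simpl; intros H; [exact C1_nz|].
apply Cmult_neq_0; auto.
Qed.

Lemma not_npint_plus a k : not_npint a -> a + RtoC (INR k) <> 0.
Proof.
intros H E; apply (H k); rewrite RtoC_opp.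
replace a with (a + RtoC (INR k) - RtoC (INR k)) by ring; rewrite E; ring.
Qed.

Lemma npint_poch_neq_0 a n : not_npint a -> poch a n <> 0.
Proof. intros H; apply poch_neq_0; intros; apply not_npint_plus, H. Qed.

Lemma not_npint_S a : not_npint a -> not_npint (a + 1).
Proof.
intros H k E; apply (H (S k)); rewrite S_INR.
replace a with (a + 1 - 1) by ring; rewrite E, <- RtoC_minus; f_equal; ring.
Qed.

Lemma poch_eq_0 a n : poch a n = 0 -> exists k, a = - RtoC (INR k).
Proof.
induction n as [|n IH]; simpl; intros H; [destruct (C1_nz H)|].
destruct (Cmult_integral _ _ H) as [H1|H1]; [auto|].
exists n; replace a with (a + RtoC (INR n) - RtoC (INR n)) by ring; rewrite H1; ring.
Qed.

Lemma poch_neg_large q n : (q < n)%nat -> poch (- RtoC (INR q)) n = 0.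
Proof.
induction n as [|n IH]; intros H; [lia|simpl].
destruct (Nat.eq_dec q n) as [->|Hq]; [ring|].
rewrite IH by lia; ring.
Qed.

(** Compares coefficients in [(1 - x)^(-a) (1 - x)^(-b) = (1 - x)^(-a-b)]. The Leibniz rule for the
    product becomes the splitting [N + 1 = i + j], after which both sides obey the recurrence
    [pdiv_S] with parameter [a + b]. *)
Lemma vandermonde a b N :
  diag (fun i j => pdiv a i * pdiv b j) N = pdiv (a + b) N.
Proof.
induction N as [|N IH]; [simpl; rewrite !pdiv_0; ring|].
assert (H : (RtoC (INR N) + 1) * diag (fun i j => pdiv a i * pdiv b j) (S N)
            = (a + b + RtoC (INR N)) * diag (fun i j => pdiv a i * pdiv b j) N).
{ rewrite <- !diag_scal.
  rewrite (diag_ext _ (fun i j => RtoC (INR i) * pdiv a i * pdiv b j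
                        + pdiv a i * (RtoC (INR j) * pdiv b j))).
  2:{ intros i j E; rewrite <- RtoC_S, <- E, RtoC_INR_plus; ring. }
  rewrite (diag_plus (fun i j => RtoC (INR i) * pdiv a i * pdiv b j)).
  rewrite (diag_S_r (fun i j => pdiv a i * (RtoC (INR j) * pdiv b j))).
  change (diag (fun i j => RtoC (INR i) * pdiv a i * pdiv b j) (S N))
    with (RtoC (INR 0) * pdiv a 0 * pdiv b (S N)
          + diag (fun i j => RtoC (INR (S i)) * pdiv a (S i) * pdiv b j) N).
  rewrite (diag_ext (fun i j => RtoC (INR (S i)) * pdiv a (S i) * pdiv b j)
             (fun i j => (a + RtoC (INR i)) * pdiv a i * pdiv b j))
    by (intros; rewrite RtoC_S, pdiv_S; ring).
  rewrite (diag_ext (fun i j => pdiv a i * (RtoC (INR (S j)) * pdiv b (S j)))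
             (fun i j => (b + RtoC (INR j)) * (pdiv a i * pdiv b j)))
    by (intros; rewrite RtoC_S, pdiv_S; ring).
  rewrite (diag_ext (fun i j => (a + b + RtoC (INR N)) * (pdiv a i * pdiv b j))
     (fun i j => (a + RtoC (INR i)) * pdiv a i * pdiv b j
                 + (b + RtoC (INR j)) * (pdiv a i * pdiv b j)))
    by (intros i j <-; rewrite RtoC_INR_plus; ring).
  rewrite (diag_plus (fun i j => (a + RtoC (INR i)) * pdiv a i * pdiv b j)).
  simpl (INR 0); ring. }
rewrite IH in H; rewrite <- pdiv_S in H.
replace (diag (fun i j => pdiv a i * pdiv b j) (S N)) with
  ((RtoC (INR N) + 1) * diag (fun i j => pdiv a i * pdiv b j) (S N) / (RtoC (INR N) + 1))
  by (field; apply S_neq_0).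
rewrite H; field; apply S_neq_0.
Qed.

(** Absorption, [j (b)_j / j! = b (b+1)_(j-1) / (j-1)!], reduces this to [vandermonde] for [a] and
    [b + 1]; absorption at the total index then restores [a + b]. *)
Lemma vandermonde_weighted a b N : a + b <> 0 ->
  diag (fun i j => pdiv a i * (RtoC (INR j) * pdiv b j)) N
  = b / (a + b) * (RtoC (INR N) * pdiv (a + b) N).
Proof.
intros Hab; destruct N as [|N]; [simpl; ring|].
assert (Hs : forall z k, RtoC (INR (S k)) * pdiv z (S k) = z * pdiv (z + 1) k).
{ intros z k; unfold pdiv; rewrite poch_S_l, fact_S_C, RtoC_S; field.
  split; [apply fact_neq_0C | apply S_neq_0]. }
rewrite diag_S_r.
rewrite (diag_ext _ (fun i j => b * (pdiv a i * pdiv (b + 1) j)))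
  by (intros; rewrite Hs; ring).
rewrite diag_scal, vandermonde, Hs.
replace (a + (b + 1)) with (a + b + 1) by ring.
simpl (INR 0); field; exact Hab.
Qed.

(* [bdiff n f k = sum_r C(n,r) f (k + r)], i.e. the operator [(1 + E)^n]
   with [E] the shift. *)
Fixpoint bdiff (n : nat) (f : nat -> C) (k : nat) : C :=
  match n with O => f k | S n => bdiff n f k + bdiff n f (S k) end.

Lemma csum_binomial n f k :
  csum (fun r => RtoC (Binomial.C n r) * f (k + r)%nat) (S n) = bdiff n f k.
Proof.
revert k; induction n as [|n IH]; intros k.
- simpl; rewrite C_n_0, Nat.add_0_r; ring.
- cbn [bdiff]; rewrite <- !IH.
  rewrite csum_S_l, (csum_S_l (fun r => RtoC (Binomial.C n r) * f (k + r)%nat)).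
  cbn [csum]; rewrite !C_n_0, !C_n_n.
  rewrite (csum_ext (fun r => RtoC (Binomial.C (S n) (S r)) * f (k + S r)%nat)
    (fun r => RtoC (Binomial.C n (S r)) * f (k + S r)%nat
              + RtoC (Binomial.C n r) * f (S k + r)%nat)).
  2:{ intros r Hr; rewrite <- pascal, RtoC_plus by exact Hr.
      replace (S k + r)%nat with (k + S r)%nat by lia; ring. }
  rewrite csum_plus.
  replace (S k + n)%nat with (k + S n)%nat by lia; ring.
Qed.

Lemma bdiff_ext n f g k : (forall j, f j = g j) -> bdiff n f k = bdiff n g k.
Proof.
intros H; revert k; induction n as [|n IH]; intros k; simpl; [apply H|].
rewrite !IH; reflexivity.
Qed.

Lemma bdiff_shift n f k : bdiff n (fun j => f (S j)) k = bdiff n f (S k).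
Proof.
revert k; induction n as [|n IH]; intros k; simpl; [reflexivity|].
rewrite !IH; reflexivity.
Qed.

(** Leibniz rule for the shift: since [E j = (j + 1) E], moving the factor [j] past [(1 + E)^(n+1)]
    leaves the commutator [(n + 1) E (1 + E)^n]. *)
Lemma bdiff_mult_var n f k (c : C) :
  bdiff (S n) (fun j => (c + RtoC (INR j)) * f j) k
  = (c + RtoC (INR k)) * bdiff (S n) f k + RtoC (INR (S n)) * bdiff n f (S k).
Proof.
revert k; induction n as [|n IH]; intros k.
- cbn [bdiff]; rewrite RtoC_S; simpl; ring.
- change (bdiff (S (S n)) (fun j => (c + RtoC (INR j)) * f j) k) with
    (bdiff (S n) (fun j => (c + RtoC (INR j)) * f j) k
     + bdiff (S n) (fun j => (c + RtoC (INR j)) * f j) (S k)).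
  rewrite !IH; cbn [bdiff]; rewrite !RtoC_S; ring.
Qed.

(** The binomial weights have total mass [2^q] and mean [q / 2]. *)
Lemma bdiff_binomial_linear q c k :
  bdiff q (fun n => 1 + c * RtoC (INR n)) k
  = Cpow 2 q * (1 + c * (RtoC (INR k) + RtoC (INR q) / 2)).
Proof.
revert k; induction q as [|q IH]; intros k; simpl bdiff.
- simpl; field.
- rewrite !IH, !RtoC_S; cbn [Cpow]; field.
Qed.

(** Partial fractions of [i! / (y (y+1) ... (y+i))], whose residues are [(-1)^r C(i,r)]. The sign
    inside the summand turns [1 + E] into a difference, so each induction step subtracts two
    neighbouring reciprocals. *)
Lemma inv_shift_bdiff i (y : C) k :
  (forall r, (r <= i)%nat -> y + RtoC (INR (k + r)) <> 0) ->
  bdiff i (fun r => cpown (-1) r / (y + RtoC (INR r))) k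
  = cpown (-1) k * RtoC (INR (fact i)) / poch (y + RtoC (INR k)) (S i).
Proof.
revert k; induction i as [|i IH]; intros k H.
- simpl; specialize (H O (le_n _)); rewrite Nat.add_0_r in H; field; exact H.
- simpl bdiff; rewrite !IH.
  2:{ intros r Hr; replace (S k + r)%nat with (k + S r)%nat by lia; apply H; lia. }
  2:{ intros r Hr; apply H; lia. }
  rewrite fact_S_C, (poch_S_l _ (S i)).
  assert (H0 : y + RtoC (INR k) <> 0)
    by (specialize (H O ltac:(lia)); rewrite Nat.add_0_r in H; exact H).
  assert (H1 : y + RtoC (INR k) + 1 + RtoC (INR i) <> 0).
  { specialize (H (S i) ltac:(lia)); rewrite RtoC_INR_plus, RtoC_S in H.
    intros E; apply H; rewrite <- E; ring. }
  assert (H2 : poch (y + RtoC (INR k) + 1) i <> 0).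
  { apply poch_neq_0; intros j Hj E.
    apply (H (S j) ltac:(lia)); rewrite RtoC_INR_plus, RtoC_S, <- E; ring. }
  rewrite (poch_S_l (y + RtoC (INR k)) i), (RtoC_S k).
  replace (y + (RtoC (INR k) + 1)) with (y + RtoC (INR k) + 1) by ring.
  simpl poch; simpl cpown.
  field; repeat split; auto.
Qed.

(** With [x = beta / 2] and [i = k + 2] this is the quotient of the two Gamma values in the second
    finite sum. *)
Definition halfpoch (x : C) (k r : nat) : C :=
  poch ((x + RtoC (INR r) - RtoC (INR k)) / 2) k.

(** Raising [k] lowers the base point by one half; splitting off the first factor raises it by one,
    which gives the base point belonging to [r + 1]. *)
Lemma halfpoch_S x k r :
  halfpoch x (S k) r
  = (x - RtoC (INR k) - 1 + RtoC (INR r)) * (halfpoch x k (S r) / 2).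
Proof.
unfold halfpoch; rewrite poch_S_l, !RtoC_S.
replace ((x + RtoC (INR r) - (RtoC (INR k) + 1)) / 2 + 1)
  with ((x + (RtoC (INR r) + 1) - RtoC (INR k)) / 2) by field.
field.
Qed.

Lemma bdiff_scal c n f k : bdiff n (fun j => c * f j) k = c * bdiff n f k.
Proof.
revert k; induction n as [|n IH]; intros k; simpl; [|rewrite !IH]; ring.
Qed.

(* Induction on [k]: [halfpoch x (k+1)] is a linear factor times a shift of
   [halfpoch x k], and [bdiff_mult_var] moves that factor through [(1 + E)^(k+2)]. *)
Lemma bdiff_halfpoch x k j :
  bdiff (S k) (halfpoch x k) j = 2 * poch (x + RtoC (INR j)) k.
Proof.
revert j; induction k as [|k IH]; intros j; [simpl; unfold halfpoch; simpl; ring|].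
rewrite (bdiff_ext _ _ _ _ (halfpoch_S x k)), bdiff_mult_var.
rewrite (bdiff_ext _ (fun r => halfpoch x k (S r) / 2)
          (fun r => /2 * halfpoch x k (S r))) by (intros; unfold Cdiv; ring).
rewrite (bdiff_ext (S k) (fun r => halfpoch x k (S r) / 2)
          (fun r => /2 * halfpoch x k (S r))) by (intros; unfold Cdiv; ring).
rewrite !bdiff_scal, !(bdiff_shift _ (halfpoch x k)).
change (bdiff (S (S k)) (halfpoch x k) (S j)) with
  (bdiff (S k) (halfpoch x k) (S j) + bdiff (S k) (halfpoch x k) (S (S j))).
rewrite !IH, (poch_S_l (x + RtoC (INR j))), !RtoC_S.
replace (x + (RtoC (INR j) + 1 + 1)) with (x + RtoC (INR j) + 1 + 1) by ring.
replace (x + (RtoC (INR j) + 1)) with (x + RtoC (INR j) + 1) by ring.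
set (u := x + RtoC (INR j) + 1).
assert (Hu : u * poch (u + 1) k = poch u k * (u + RtoC (INR k)))
  by (rewrite <- poch_S_l; reflexivity).
set (P := poch (u + 1) k) in *.
transitivity (((x - RtoC (INR k) - 1 + RtoC (INR j)) * poch u k + u * P)).
- unfold u; field.
- rewrite Hu; unfold u; ring.
Qed.

(** * Limits, Cesaro means and antidiagonals *)

(** Componentwise, because [CGamma] is made of the limits of real and imaginary parts; [clim_spec]
    passes to the modulus. *)
Definition clim (u : nat -> C) (l : C) : Prop :=
  is_lim_seq (fun n => Re (u n)) (Re l) /\ is_lim_seq (fun n => Im (u n)) (Im l).

Lemma im_le_Cmod c : (Rabs (Im c) <= Cmod c)%R.
Proof.
apply Rle_trans with (2 := Rmax_Cmod c); apply Rmax_r.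
Qed.

Lemma Cmod_le_Re_Im c : (Cmod c <= Rabs (Re c) + Rabs (Im c))%R.
Proof.
destruct c as [x y]; simpl.
replace (x, y) with (RtoC x + Ci * RtoC y)
  by (unfold Cplus, Cmult, RtoC, Ci; simpl; f_equal; ring).
eapply Rle_trans; [apply Cmod_triangle|].
rewrite Cmod_mult, Cmod_Ci, !Cmod_R; lra.
Qed.

Lemma Re_minus (a b : C) : Re (a - b) = (Re a - Re b)%R.
Proof. reflexivity. Qed.

Lemma Im_minus (a b : C) : Im (a - b) = (Im a - Im b)%R.
Proof. reflexivity. Qed.

Lemma clim_spec u l :
  clim u l <-> forall eps : R, (0 < eps)%R ->
    exists N, forall n, (N <= n)%nat -> (Cmod (u n - l) < eps)%R.
Proof.
split.
- intros [H1 H2] eps He.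
  apply is_lim_seq_spec in H1, H2.
  destruct (H1 (pos_div_2 (mkposreal _ He))) as [N1 h1].
  destruct (H2 (pos_div_2 (mkposreal _ He))) as [N2 h2].
  exists (max N1 N2); intros n Hn.
  specialize (h1 n ltac:(lia)); specialize (h2 n ltac:(lia)); simpl in h1, h2.
  eapply Rle_lt_trans; [apply Cmod_le_Re_Im|].
  rewrite !Re_minus, !Im_minus; lra.
- intros H; split; apply is_lim_seq_spec; intros eps;
    destruct (H eps (cond_pos eps)) as [N h]; exists N; intros n Hn;
    (eapply Rle_lt_trans; [|apply (h n Hn)]).
  + rewrite <- Re_minus; apply re_le_Cmod.
  + rewrite <- Im_minus; apply im_le_Cmod.
Qed.

Lemma clim_ext u v l : (forall n, u n = v n) -> clim u l -> clim v l.
Proof.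
intros E [H1 H2]; split;
  [eapply is_lim_seq_ext; [|exact H1] | eapply is_lim_seq_ext; [|exact H2]];
  intros n; simpl; rewrite E; reflexivity.
Qed.

Lemma clim_eq u l l' : clim u l -> l = l' -> clim u l'.
Proof. intros H <-; exact H. Qed.

Lemma clim_const c : clim (fun _ => c) c.
Proof. split; apply is_lim_seq_const. Qed.

Lemma clim_plus u v a b : clim u a -> clim v b -> clim (fun n => u n + v n) (a + b).
Proof.
intros [H1 H2] [H3 H4]; split; simpl.
- apply (is_lim_seq_plus' _ _ _ _ H1 H3).
- apply (is_lim_seq_plus' _ _ _ _ H2 H4).
Qed.

Lemma clim_mult u v a b : clim u a -> clim v b -> clim (fun n => u n * v n) (a * b).
Proof.
intros [H1 H2] [H3 H4]; split; simpl.
- apply is_lim_seq_minus'; apply is_lim_seq_mult'; assumption.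
- apply is_lim_seq_plus'; apply is_lim_seq_mult'; assumption.
Qed.

Lemma clim_opp u a : clim u a -> clim (fun n => - u n) (- a).
Proof.
intros [H1 H2]; split; simpl.
- apply (is_lim_seq_opp _ (Finite (Re a))); exact H1.
- apply (is_lim_seq_opp _ (Finite (Im a))); exact H2.
Qed.

Lemma clim_minus u v a b : clim u a -> clim v b -> clim (fun n => u n - v n) (a - b).
Proof. intros H1 H2; apply clim_plus; [|apply clim_opp]; assumption. Qed.

Lemma clim_incr_1 u l : clim u l -> clim (fun n => u (S n)) l.
Proof.
intros [H1 H2]; split.
- apply (is_lim_seq_incr_1 (fun n => Re (u n))); exact H1.
- apply (is_lim_seq_incr_1 (fun n => Im (u n))); exact H2.
Qed.

Lemma clim_csum (u : nat -> nat -> C) l m : (forall i, clim (u i) (l i)) ->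
  clim (fun n => csum (fun i => u i n) m) (csum l m).
Proof.
intros H; induction m as [|m IH]; simpl; [apply clim_const|].
apply clim_plus; auto.
Qed.

Lemma clim_inv_shift b : clim (fun n => / (b + RtoC (INR n))) 0.
Proof.
apply clim_spec; intros eps He.
destruct (nfloor_ex (Cmod b + / eps)) as [N [_ HN]].
{ apply Rplus_le_le_0_compat; [apply Cmod_ge_0|]. left; apply Rinv_0_lt_compat, He. }
exists (S N); intros n Hn.
assert (h : (Cmod b + / eps < INR n)%R).
{ apply Rlt_le_trans with (1 := HN); rewrite <- S_INR; apply le_INR, Hn. }
assert (h2 : (/ eps < Cmod (b + RtoC (INR n)))%R).
{ assert (T := Cmod_triangle (b + RtoC (INR n)) (- b)).
  replace (b + RtoC (INR n) + - b) with (RtoC (INR n)) in T by ring.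
  rewrite Cmod_opp, Cmod_R, Rabs_pos_eq in T by apply pos_INR; lra. }
assert (h3 : (0 < / eps)%R) by apply Rinv_0_lt_compat, He.
replace (/ (b + RtoC (INR n)) - 0) with (/ (b + RtoC (INR n))) by ring.
rewrite Cmod_inv by (apply Cmod_gt_0; lra).
rewrite <- (Rinv_inv eps); apply Rinv_lt_contravar; [|exact h2].
apply Rmult_lt_0_compat; lra.
Qed.

Lemma clim_shift_ratio a b : not_npint b ->
  clim (fun n => (a + RtoC (INR n)) / (b + RtoC (INR n))) 1.
Proof.
intros Hb.
apply clim_ext with (fun n => 1 + (a - b) * / (b + RtoC (INR n))).
{ intros n; field; apply not_npint_plus, Hb. }
apply clim_eq with (1 + (a - b) * 0); [|ring].
apply clim_plus; [apply clim_const|].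
apply clim_mult; [apply clim_const | apply clim_inv_shift].
Qed.

Lemma not_npint_INR b k : not_npint b -> not_npint (b + RtoC (INR k)).
Proof.
intros H j E; apply (H (j + k)%nat); rewrite plus_INR.
replace b with (b + RtoC (INR k) - RtoC (INR k)) by ring.
rewrite E, <- RtoC_minus; f_equal; ring.
Qed.

Lemma not_npint_1 : not_npint 1.
Proof. intros k E; injection E; assert (H := pos_INR k); lra. Qed.

Lemma clim_poch_ratio a b m : not_npint b ->
  clim (fun n => poch (a + RtoC (INR n)) m / poch (b + RtoC (INR n)) m) 1.
Proof.
intros Hb; induction m as [|m IH].
- apply clim_ext with (fun _ => 1); [intros; simpl; field | apply clim_const].
- apply clim_ext with (fun n => poch (a + RtoC (INR n)) m / poch (b + RtoC (INR n)) m
    * ((a + RtoC (INR m) + RtoC (INR n)) / (b + RtoC (INR m) + RtoC (INR n)))).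
  { intros n; simpl.
    replace (a + RtoC (INR m) + RtoC (INR n)) with (a + RtoC (INR n) + RtoC (INR m)) by ring.
    replace (b + RtoC (INR m) + RtoC (INR n)) with (b + RtoC (INR n) + RtoC (INR m)) by ring.
    field; split.
    - apply not_npint_plus, not_npint_INR, Hb.
    - apply npint_poch_neq_0, not_npint_INR, Hb. }
  apply clim_eq with (1 * 1); [|ring].
  apply clim_mult; [exact IH|].
  apply clim_shift_ratio, not_npint_INR, Hb.
Qed.

(** * Bounded sequences and sequences of growth o(n) *)

Definition cbounded (u : nat -> C) : Prop := exists K : R, forall n, (Cmod (u n) <= K)%R.

Lemma cbounded_ev u K N :
  (forall n, (N <= n)%nat -> (Cmod (u n) <= K)%R) -> cbounded u.
Proof.
revert K; induction N as [|N IH]; intros K H; [exists K; intros; apply H; lia|].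
apply (IH (Rmax K (Cmod (u N)))); intros n Hn.
destruct (Nat.eq_dec n N) as [->|]; [apply Rmax_r|].
eapply Rle_trans; [apply H; lia | apply Rmax_l].
Qed.

Lemma cbounded_mult u v l : cbounded u -> clim v l -> cbounded (fun n => u n * v n).
Proof.
intros [K HK] Hv; rewrite clim_spec in Hv; destruct (Hv 1%R Rlt_0_1) as [N h].
apply (cbounded_ev _ (K * (1 + Cmod l)) N); intros n Hn; rewrite Cmod_mult.
apply Rmult_le_compat; [apply Cmod_ge_0 | apply Cmod_ge_0 | apply HK|].
specialize (h n Hn); assert (T := Cmod_triangle (v n - l) l).
replace (v n - l + l) with (v n) in T by ring; lra.
Qed.

(** Once [v] is within [Cmod l / 2] of [l], its modulus exceeds [Cmod l / 2], so dividing by it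
    costs only a constant. *)
Lemma cbounded_div u v (l : C) :
  l <> 0 -> clim v l -> cbounded (fun n => u n * v n) -> cbounded u.
Proof.
intros Hl Hv [K HK]; rewrite clim_spec in Hv; apply Cmod_gt_0 in Hl.
destruct (Hv (Cmod l / 2)%R ltac:(lra)) as [N h].
apply (cbounded_ev _ (K / (Cmod l / 2)) N); intros n Hn.
specialize (h n Hn); assert (T := Cmod_triangle (l - v n) (v n)).
replace (l - v n + v n) with l in T by ring.
replace (l - v n) with (- (v n - l)) in T by ring; rewrite Cmod_opp in T.
specialize (HK n); rewrite Cmod_mult in HK.
apply Rle_div_r; [lra|].
apply Rle_trans with (2 := HK); apply Rmult_le_compat_l; [apply Cmod_ge_0 | lra].
Qed.

Lemma cbounded_clim0 u v : cbounded u -> clim v 0 -> clim (fun n => u n * v n) 0.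
Proof.
intros [K HK] Hv; rewrite clim_spec in Hv |- *; intros eps He.
assert (K0 : (0 <= K)%R) by (eapply Rle_trans; [apply Cmod_ge_0 | apply (HK O)]).
assert (K1 : (0 < K + 1)%R) by lra.
destruct (Hv (eps / (K + 1))%R ltac:(apply Rdiv_lt_0_compat; lra)) as [N h].
exists N; intros n Hn; specialize (h n Hn); specialize (HK n).
replace (u n * v n - 0) with (u n * (v n - 0)) by ring; rewrite Cmod_mult.
apply Rle_lt_trans with (K * Cmod (v n - 0))%R.
{ apply Rmult_le_compat_r; [apply Cmod_ge_0 | exact HK]. }
apply Rle_lt_trans with ((K + 1) * Cmod (v n - 0))%R.
{ apply Rmult_le_compat_r; [apply Cmod_ge_0 | lra]. }
apply Rlt_div_r in h; [|exact K1]; lra.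
Qed.

(** Normalised by [n + 1], the number of entries on the antidiagonal of index [n]. *)
Definition littleo (u : nat -> C) : Prop :=
  forall d : R, (0 < d)%R ->
    exists N, forall n, (N <= n)%nat -> (Cmod (u n) <= d * (INR n + 1))%R.

Lemma littleo_ext u v : (forall n, u n = v n) -> littleo u -> littleo v.
Proof.
intros E H d Hd; destruct (H d Hd) as [N h]; exists N; intros n Hn.
rewrite <- E; auto.
Qed.

Lemma littleo_plus u v : littleo u -> littleo v -> littleo (fun n => u n + v n).
Proof.
intros Hu Hv d Hd.
destruct (Hu (d / 2)%R ltac:(lra)) as [N1 h1], (Hv (d / 2)%R ltac:(lra)) as [N2 h2].
exists (max N1 N2); intros n Hn.
specialize (h1 n ltac:(lia)); specialize (h2 n ltac:(lia)).
assert (T := Cmod_triangle (u n) (v n)); lra.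
Qed.

Lemma littleo_scal c u : littleo u -> littleo (fun n => c * u n).
Proof.
intros Hu d Hd; assert (Hc := Cmod_ge_0 c).
destruct (Hu (d / (Cmod c + 1))%R ltac:(apply Rdiv_lt_0_compat; lra)) as [N h].
exists N; intros n Hn; specialize (h n Hn); rewrite Cmod_mult.
apply Rle_trans with ((Cmod c + 1) * Cmod (u n))%R.
{ apply Rmult_le_compat_r; [apply Cmod_ge_0 | lra]. }
apply Rmult_le_compat_l with (r := (Cmod c + 1)%R) in h; [|lra].
replace (d * (INR n + 1))%R with
  ((Cmod c + 1) * (d / (Cmod c + 1) * (INR n + 1)))%R by (field; lra); exact h.
Qed.

Lemma littleo_bounded u : cbounded u -> littleo u.
Proof.
intros [K HK] d Hd.
assert (K0 : (0 <= K)%R) by (eapply Rle_trans; [apply Cmod_ge_0 | apply (HK O)]).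
destruct (nfloor_ex (K / d)) as [N [_ HN]].
{ apply Rdiv_le_0_compat; lra. }
exists N; intros n Hn; apply Rle_trans with (1 := HK n).
apply le_INR in Hn; apply Rlt_div_l in HN; [|lra].
apply Rle_trans with ((INR N + 1) * d)%R; [lra|].
rewrite Rmult_comm; apply Rmult_le_compat_l; lra.
Qed.

Lemma littleo_csum_family (u : nat -> nat -> C) m :
  (forall i, littleo (u i)) -> littleo (fun n => csum (fun i => u i n) m).
Proof.
intros H; induction m as [|m IH]; simpl.
- apply littleo_bounded; exists 0%R; intros; rewrite Cmod_0; lra.
- apply littleo_plus; auto.
Qed.

Lemma cesaro_littleo v : clim v 0 -> littleo (csum v).
Proof.
intros Hv d Hd; rewrite clim_spec in Hv.
destruct (Hv (d / 2)%R ltac:(lra)) as [N h].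
(* From [N] on every term is below [d / 2]; the fixed head is absorbed by the other half of [d]. *)
assert (B : forall k, (Cmod (csum v (k + N)) <= Cmod (csum v N) + d / 2 * INR k)%R).
{ induction k as [|k IH]; simpl csum; [simpl INR; simpl; lra|].
  rewrite S_INR.
  specialize (h (k + N)%nat ltac:(lia)).
  replace (v (k + N)%nat - 0) with (v (k + N)%nat) in h by ring.
  assert (T := Cmod_triangle (csum v (k + N)) (v (k + N)%nat)); lra. }
destruct (littleo_bounded (fun _ => csum v N)
  ltac:(exists (Cmod (csum v N)); intros; lra) (d / 2)%R ltac:(lra)) as [N2 h2].
exists (max N N2); intros n Hn.
specialize (B (n - N)%nat); replace (n - N + N)%nat with n in B by lia.
specialize (h2 n ltac:(lia)).
assert (INR (n - N) <= INR n)%R by (apply le_INR; lia).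
assert (d / 2 * INR (n - N) <= d / 2 * INR n)%R by (apply Rmult_le_compat_l; lra).
lra.
Qed.

(* [2 sum u = sum (u_j + u_(j+1)) +] boundary terms *)
Lemma alternating_littleo u :
  cbounded u -> clim (fun n => u n + u (S n)) 0 -> littleo (csum u).
Proof.
intros Hu Hc.
apply littleo_ext with (fun n => / 2 * (csum (fun k => u k + u (S k)) n
  + (u O + - 1 * u n))).
{ intros n; rewrite csum_plus.
  assert (E : csum (fun k => u (S k)) n = csum u n + u n - u O).
  { replace (csum u n + u n) with (csum u (S n)) by reflexivity.
    rewrite csum_S_l; ring. }
  rewrite E; field. }
apply littleo_scal, littleo_plus; [apply cesaro_littleo, Hc|].
apply littleo_plus.
- apply littleo_bounded; exists (Cmod (u O)); intros; lra.
- apply littleo_scal, littleo_bounded, Hu.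
Qed.

(** * Rows and columns of the double array *)

Lemma cpown_plus z m n : cpown z (m + n) = cpown z m * cpown z n.
Proof. induction m as [|m IH]; simpl; [|rewrite IH]; ring. Qed.

(** The summand at [x = y = -1]. The factors in [m] alone and in [n] alone stay arbitrary, so that
    columns are the rows of the array with [A] and [B] exchanged. *)
Definition term (alpha beta : C) (A B : nat -> C) (m n : nat) : C :=
  cpown (-1) (m + n) * (poch alpha (m + n) / poch beta (m + n)) * (A m * B n).

Definition psum (t : nat -> nat -> C) (m n : nat) : C :=
  csum (fun i => csum (fun j => t i j) n) m.

Lemma term_sym alpha beta A B m n :
  term alpha beta A B m n = term alpha beta B A n m.
Proof. unfold term; rewrite (Nat.add_comm n m); ring. Qed.

(** The quotient of row [m] by row 0 at place [n]. Its limit in [n] is a constant, so every row is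
    asymptotically a multiple of row 0. *)
Definition row_factor (alpha beta : C) (A : nat -> C) (m n : nat) : C :=
  cpown (-1) m * A m * (poch (alpha + RtoC (INR n)) m / poch (beta + RtoC (INR n)) m).

Lemma term_row alpha beta (A B : nat -> C) m n : not_npint beta -> A O = 1 ->
  term alpha beta A B m n
  = term alpha beta A B 0 n * row_factor alpha beta A m n.
Proof.
intros Hb HA; unfold term, row_factor; rewrite HA; simpl Nat.add.
rewrite !poch_add, cpown_plus; field; split.
- apply npint_poch_neq_0, not_npint_INR, Hb.
- apply npint_poch_neq_0, Hb.
Qed.

Lemma clim_row_factor alpha beta A m : not_npint beta ->
  clim (row_factor alpha beta A m) (cpown (-1) m * A m).
Proof.
intros Hb; replace (cpown (-1) m * A m) with (cpown (-1) m * A m * 1) by ring.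
apply clim_mult; [apply clim_const | apply clim_poch_ratio, Hb].
Qed.

Definition corner_bounded (s : nat -> nat -> C) : Prop :=
  exists (K : R) (M N : nat), forall m n, (M <= m)%nat -> (N <= n)%nat ->
    (Cmod (s m n) <= K)%R.

(* The increments in [n] of the double partial sums are [term 0 n] times a factor
   tending to an alternating sum of the weights, which is nonzero for a suitable [m]. *)
Lemma row0_bounded alpha beta (A B : nat -> C) : not_npint beta -> A O = 1 ->
  corner_bounded (psum (term alpha beta A B)) ->
  (forall M, exists m, (M <= m)%nat /\ csum (fun i => cpown (-1) i * A i) m <> 0) ->
  cbounded (term alpha beta A B 0).
Proof.
intros Hb HA (K & M & N & HK) Hne.
destruct (Hne M) as (m & Hm & Hnz).
apply cbounded_div with (1 := Hnz)
  (v := fun n => csum (fun i => row_factor alpha beta A i n) m).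
{ apply clim_csum; intros i; apply clim_row_factor, Hb. }
apply (cbounded_ev _ (K + K) N); intros n Hn.
replace (term alpha beta A B 0 n * csum (fun i => row_factor alpha beta A i n) m)
  with (psum (term alpha beta A B) m (S n) + - psum (term alpha beta A B) m n).
- eapply Rle_trans; [apply Cmod_triangle|]; rewrite Cmod_opp.
  apply Rplus_le_compat; apply HK; lia.
- unfold psum; simpl; rewrite csum_plus, <- csum_scal.
  rewrite (csum_ext (fun k => term alpha beta A B 0 n * row_factor alpha beta A k n)
             (fun k => term alpha beta A B k n))
    by (intros; rewrite <- term_row; auto).
  ring.
Qed.

(** [r] is the ratio of successive weights. As it tends to 1 and the signs alternate, neighbouring
    terms of a bounded row nearly cancel, as [alternating_littleo] requires. *)
Lemma row_littleo alpha beta (A B r : nat -> C) : not_npint beta -> A O = 1 ->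
  cbounded (term alpha beta A B 0) ->
  (forall n, B (S n) = B n * r n) -> clim r 1 ->
  forall m, littleo (fun n => psum (term alpha beta A B) m n).
Proof.
intros Hb HA Ht HB Hr m; apply littleo_csum_family; intros i.
apply (littleo_ext (csum (term alpha beta A B i))); [reflexivity|].
assert (E : forall n, term alpha beta A B i n
   = term alpha beta A B 0 n * row_factor alpha beta A i n)
  by (intros n; apply term_row; assumption).
assert (Hf := clim_row_factor alpha beta A i Hb).
apply alternating_littleo.
- destruct (cbounded_mult _ _ _ Ht Hf) as [K HK].
  exists K; intros n; rewrite E; apply HK.
- apply clim_ext with (fun n => term alpha beta A B 0 n *
    (row_factor alpha beta A i n
     - (alpha + RtoC (INR n)) / (beta + RtoC (INR n)) * r n
       * row_factor alpha beta A i (S n))).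
  { intros n; rewrite !E; unfold term; rewrite HB; simpl; field.
    split; [apply not_npint_plus, Hb | apply npint_poch_neq_0, Hb]. }
  apply cbounded_clim0; [exact Ht|].
  apply clim_eq with (cpown (-1) i * A i - 1 * 1 * (cpown (-1) i * A i)); [|ring].
  apply clim_minus; [exact Hf|].
  apply clim_mult; [|apply (clim_incr_1 (row_factor alpha beta A i)), Hf].
  apply clim_mult; [apply clim_shift_ratio, Hb | exact Hr].
Qed.

(* If the sums vanished from some point on, [b] would be [-q] and they would all
   equal [2^q (1 + c q / 2)]. *)
Lemma weight_sums_nonzero b c :
  (forall q, c * RtoC (INR q) <> - (2)) ->
  forall M, exists m, (M <= m)%nat /\
    csum (fun i => cpown (-1) i * (pdiv b i * (1 + c * RtoC (INR i)))) m <> 0.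
Proof.
intros Hc M.
set (w := fun i => cpown (-1) i * (pdiv b i * (1 + c * RtoC (INR i)))).
destruct (Classical_Prop.classic
  (exists m, (M <= m)%nat /\ csum w m <> 0)) as [h|h]; [exact h|].
assert (Z : forall m, (M <= m)%nat -> csum w m = 0).
{ intros m Hm; destruct (Ceq_dec (csum w m) 0) as [|Hn]; [assumption|].
  exfalso; apply h; exists m; auto. }
assert (W : forall m, (M <= m)%nat -> w m = 0).
{ intros m Hm; assert (Z1 := Z (S m) ltac:(lia)); simpl in Z1.
  rewrite Z in Z1 by exact Hm; rewrite <- Z1; ring. }
assert (Hs : forall n, cpown (-1) n <> 0).
{ induction n as [|n IH]; simpl; [exact C1_nz|].
  apply Cmult_neq_0; [exact IH|]; apply RtoC_neq_0; lra. }
(* Two consecutive weights vanish. If [pdiv b] were nonzero at both places, both linear factors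
   would vanish, forcing [c = 0] and then [1 = 0]. *)
assert (Hp : exists n, pdiv b n = 0).
{ destruct (Cmult_integral _ _ (W M (le_n _))) as [F|F]; [destruct (Hs _ F)|].
  destruct (Cmult_integral _ _ F) as [|F1]; [exists M; assumption|].
  destruct (Cmult_integral _ _ (W (S M) ltac:(lia))) as [G|G]; [destruct (Hs _ G)|].
  destruct (Cmult_integral _ _ G) as [|G1]; [exists (S M); assumption|].
  exfalso; rewrite RtoC_S in G1.
  assert (c0 : c = 0).
  { replace c with (1 + c * (RtoC (INR M) + 1) - (1 + c * RtoC (INR M))) by ring.
    rewrite F1, G1; ring. }
  rewrite c0 in F1; apply C1_nz; rewrite <- F1; ring. }
destruct Hp as [n Hn].
assert (Hb : exists q, b = - RtoC (INR q)).
{ apply (poch_eq_0 b n); unfold pdiv in Hn.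
  replace (poch b n) with (poch b n / RtoC (INR (fact n)) * RtoC (INR (fact n)))
    by (field; apply fact_neq_0C).
  rewrite Hn; ring. }
destruct Hb as [q ->]; exfalso.
assert (Hbin : forall r, (r <= q)%nat ->
   cpown (-1) r * pdiv (- RtoC (INR q)) r = RtoC (Binomial.C q r)).
{ induction r as [|r IH]; intros Hr.
  - rewrite pdiv_0, C_n_0; simpl; ring.
  - rewrite pascal_step3, RtoC_mult, <- IH by lia.
    rewrite RtoC_div by (apply not_0_INR; discriminate).
    rewrite minus_INR, RtoC_minus, RtoC_S by lia.
    replace (pdiv (- RtoC (INR q)) (S r)) with
      ((RtoC (INR r) + 1) * pdiv (- RtoC (INR q)) (S r) / (RtoC (INR r) + 1))
      by (field; apply S_neq_0).
    rewrite pdiv_S; simpl; field; apply S_neq_0. }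
assert (Hq : csum w (S q) = Cpow 2 q * (1 + c * (RtoC (INR q) / 2))).
{ rewrite (csum_ext _ (fun r => RtoC (Binomial.C q r) *
     (fun n => 1 + c * RtoC (INR n)) (0 + r)%nat)).
  - rewrite (csum_binomial q (fun n => 1 + c * RtoC (INR n)) 0), bdiff_binomial_linear; simpl (INR 0); f_equal; field.
  - intros k Hk; unfold w; rewrite <- Hbin by lia; simpl; ring. }
(* Beyond [q] the rising factorial of [-q] is zero, so the sums no longer change. *)
assert (Hext : forall k, csum w (k + S q) = csum w (S q)).
{ induction k as [|k IH]; [reflexivity|].
  change (csum w (S k + S q)) with (csum w (k + S q) + w (k + S q)%nat).
  assert (w0 : w (k + S q)%nat = 0)
    by (unfold w, pdiv; rewrite poch_neg_large by lia; unfold Cdiv; ring).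
  rewrite IH, w0; ring. }
specialize (Hext M); rewrite Z, Hq in Hext by lia.
symmetry in Hext.
destruct (Cmult_integral _ _ Hext) as [F|F].
- revert F; apply Cpow_nz; apply RtoC_neq_0; lra.
- apply (Hc q).
  replace (c * RtoC (INR q)) with (2 * (1 + c * (RtoC (INR q) / 2)) - 2) by field.
  rewrite F; ring.
Qed.

(* Antidiagonal means of [f] are asymptotically at most [eps]; this is insensitive
   to finitely many rows and columns of size [o(n)]. *)
Definition mean_le (eps : R) (f : nat -> nat -> C) : Prop :=
  forall d : R, (0 < d)%R ->
    exists N, forall n, (N <= n)%nat -> (Cmod (diag f n) <= (eps + d) * (INR n + 1))%R.

Lemma mean_le_uniform eps f :
  (forall i j, (Cmod (f i j) <= eps)%R) -> mean_le eps f.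
Proof.
intros H d Hd; exists O; intros n _.
apply Rle_trans with (eps * (INR n + 1))%R.
- revert f H; induction n as [|n IH]; intros f H; cbn [diag].
  + simpl; rewrite Rplus_0_l, Rmult_1_r; apply H.
  + rewrite S_INR; assert (T := Cmod_triangle (f O (S n)) (diag (fun i j => f (S i) j) n)).
    specialize (IH (fun i j => f (S i) j) ltac:(intros; apply H)).
    specialize (H O (S n)); lra.
- apply Rmult_le_compat_r; [assert (h := pos_INR n)|]; lra.
Qed.

(** [u] holds the one entry per antidiagonal lost when the first row or column is deleted. Dividing
    by the longer antidiagonal of [f] only lowers the bound for [g], as [eps] is nonnegative. *)
Lemma mean_le_shift eps f g u : (0 <= eps)%R -> littleo u ->
  (forall n, diag f (S n) = diag g n + u (S n)) -> mean_le eps g -> mean_le eps f.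
Proof.
intros He Hu E Hg d Hd.
destruct (Hu (d / 2)%R ltac:(lra)) as [N1 h1], (Hg (d / 2)%R ltac:(lra)) as [N2 h2].
exists (S (max N1 N2)); intros [|n] Hn; [lia|].
specialize (h1 (S n) ltac:(lia)); specialize (h2 n ltac:(lia)).
rewrite E; assert (T := Cmod_triangle (diag g n) (u (S n))).
rewrite S_INR in *.
assert (0 <= INR n)%R by apply pos_INR.
assert ((eps + d / 2) * (INR n + 1) <= (eps + d / 2) * (INR n + 1 + 1))%R
  by (apply Rmult_le_compat_l; lra).
lra.
Qed.

Lemma mean_le_rows eps M f : (0 <= eps)%R ->
  (forall m, littleo (f m)) -> mean_le eps (fun i j => f (M + i)%nat j) ->
  mean_le eps f.
Proof.
intros He; revert f; induction M as [|M IH]; intros f Hf H; [exact H|].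
apply mean_le_shift with (g := fun i j => f (S i) j) (u := f O); auto.
- intros n; simpl; ring.
Qed.

Lemma mean_le_cols eps N f : (0 <= eps)%R ->
  (forall n, littleo (fun m => f m n)) -> mean_le eps (fun i j => f i (N + j)%nat) ->
  mean_le eps f.
Proof.
intros He; revert f; induction N as [|N IH]; intros f Hf H; [exact H|].
apply mean_le_shift with (g := fun i j => f i (S j)) (u := fun m => f m O); auto.
intros n; apply diag_S_r.
Qed.

Lemma littleo_shift N u : littleo u -> littleo (fun n => u (N + n)%nat).
Proof.
intros H d Hd; assert (HN := pos_INR N).
destruct (H (d / (INR N + 1))%R ltac:(apply Rdiv_lt_0_compat; lra)) as [N1 h].
exists N1; intros n Hn; specialize (h (N + n)%nat ltac:(lia)).
apply Rle_trans with (1 := h); rewrite plus_INR; assert (Hn' := pos_INR n).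
apply Rle_trans with (d / (INR N + 1) * ((INR N + 1) * (INR n + 1)))%R.
- apply Rmult_le_compat_l; [|nra]. left; apply Rdiv_lt_0_compat; lra.
- right; field; lra.
Qed.

Lemma diag_const c N : diag (fun _ _ => c) N = (RtoC (INR N) + 1) * c.
Proof.
induction N as [|N IH]; cbn [diag]; [simpl; ring|].
rewrite IH, RtoC_S; ring.
Qed.

Lemma antidiagonal_mean (s : nat -> nat -> C) L :
  (forall eps : R, (0 < eps)%R -> exists M N, forall m n,
     (M <= m)%nat -> (N <= n)%nat -> (Cmod (s m n - L) <= eps)%R) ->
  (forall m, littleo (s m)) -> (forall n, littleo (fun m => s m n)) ->
  littleo (fun N => diag s N - (RtoC (INR N) + 1) * L).
Proof.
intros Hs Hr Hc d Hd.
assert (HL : littleo (fun _ => - L))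
  by (apply littleo_bounded; exists (Cmod (- L)); intros; lra).
destruct (Hs (d / 2)%R ltac:(lra)) as (M & N & h).
(* Outside the first [M] rows and [N] columns the entries are uniformly within [d / 2] of [L]; the
   deleted rows and columns are o(n). *)
assert (H : mean_le (d / 2) (fun i j => s i j + - L)).
{ apply (mean_le_rows _ M); [lra| |].
  - intros m; apply littleo_plus; auto.
  - apply (mean_le_cols _ N); [lra| |].
    + intros n; apply littleo_plus; [|exact HL].
      apply (littleo_shift M (fun m => s m n)), Hc.
    + apply mean_le_uniform; intros i j; apply h; lia. }
destruct (H (d / 2)%R ltac:(lra)) as [N1 h1]; exists N1; intros n Hn.
specialize (h1 n Hn); rewrite (diag_plus s (fun _ _ => - L)), diag_const in h1.
replace (diag s n - (RtoC (INR n) + 1) * L)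
  with (diag s n + (RtoC (INR n) + 1) * - L) by ring.
replace d with (d / 2 + d / 2)%R by field; exact h1.
Qed.

(** [psum] sums strictly below its indices, so on generating functions restricted to [x = y] it
    multiplies by [x^2 / (1 - x)^2]. Thus the antidiagonal sums of [psum t] are twice iterated
    partial sums of [diag t], that is, unnormalised Cesaro means. *)
Lemma diag_psum_S t N :
  diag (psum t) (S N) = diag (psum t) N + csum (diag t) N.
Proof.
assert (HB : forall K, diag (fun m n => csum (fun i => t i n) m) K = csum (diag t) K).
{ induction K as [|K IH]; [reflexivity|].
  cbn [diag csum]; rewrite <- IH.
  rewrite (diag_plus (fun m n => csum (fun i => t i n) m) t); ring. }
rewrite diag_S_r.
rewrite (diag_ext _ (fun m n => psum t m n + csum (fun i => t i n) m)).
- rewrite (diag_plus (psum t)), HB.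
  unfold psum at 2; rewrite csum_exchange; simpl csum; ring.
- intros m n _; unfold psum; simpl; apply csum_plus.
Qed.

(** * Complex powers of positive reals *)

Lemma cpow_plus t z w : cpow_pos t (z + w) = cpow_pos t z * cpow_pos t w.
Proof.
unfold cpow_pos, Cmult, Re, Im; simpl.
rewrite !Rmult_plus_distr_r, exp_plus, cos_plus, sin_plus; f_equal; ring.
Qed.

Lemma cpow_exp0 t : cpow_pos t 0 = 1.
Proof.
unfold cpow_pos, RtoC; simpl; rewrite !Rmult_0_l, exp_0, cos_0, sin_0; f_equal; ring.
Qed.

Lemma cpow_base1 z : cpow_pos 1 z = 1.
Proof.
unfold cpow_pos; rewrite ln_1, !Rmult_0_r, exp_0, cos_0, sin_0.
unfold RtoC; f_equal; ring.
Qed.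

Lemma cpow_exp1 t : (0 < t)%R -> cpow_pos t 1 = RtoC t.
Proof.
intros Ht; unfold cpow_pos, RtoC; simpl.
rewrite Rmult_0_l, Rmult_1_l, exp_ln, cos_0, sin_0 by exact Ht; f_equal; ring.
Qed.

Lemma cpow_mult_base s t z : (0 < s)%R -> (0 < t)%R ->
  cpow_pos (s * t) z = cpow_pos s z * cpow_pos t z.
Proof.
intros Hs Ht; unfold cpow_pos, Cmult; simpl.
rewrite ln_mult by assumption.
rewrite !Rmult_plus_distr_l, exp_plus, cos_plus, sin_plus; f_equal; ring.
Qed.

Lemma cpow_neq_0 t z : cpow_pos t z <> 0.
Proof.
intros E; apply C1_nz.
rewrite <- (cpow_exp0 t); replace (RtoC 0) with (z + - z) by ring.
rewrite cpow_plus, E; ring.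
Qed.

Lemma Cmod_cpow t z : Cmod (cpow_pos t z) = exp (Re z * ln t).
Proof.
assert (H : (Cmod (cpow_pos t z) ^ 2 = exp (Re z * ln t) ^ 2)%R).
{ rewrite Cmod2_alt; unfold cpow_pos; simpl.
  assert (T := sin2_cos2 (Im z * ln t)); unfold Rsqr, Im in T.
  set (x := exp _); set (s := sin _) in *; set (c := cos _) in *.
  replace (x * c * (x * c * 1) + x * s * (x * s * 1))%R
    with (x * (x * 1) * (s * s + c * c))%R by ring.
  rewrite T; ring. }
rewrite <- (Rabs_pos_eq (Cmod _)) by apply Cmod_ge_0.
rewrite <- (Rabs_pos_eq (exp _)) by (left; apply exp_pos).
apply Rsqr_eq_abs_0; unfold Rsqr; simpl in H; lra.
Qed.

Lemma exp_le_mono x y : (x <= y)%R -> (exp x <= exp y)%R.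
Proof. intros [H| ->]; [left; apply exp_increasing, H | right; reflexivity]. Qed.

Lemma Cmod_cpow_le t z : (1 <= t <= 2)%R ->
  (Cmod (cpow_pos t z) <= exp (Rabs (Re z) * ln 2))%R.
Proof.
intros Ht; rewrite Cmod_cpow; apply exp_le_mono.
assert (0 <= ln t)%R by (rewrite <- ln_1; apply ln_le; lra).
assert (ln t <= ln 2)%R by (apply ln_le; lra).
apply Rle_trans with (Rabs (Re z) * ln t)%R.
- apply Rmult_le_compat_r; [lra | apply Rle_abs].
- apply Rmult_le_compat_l; [apply Rabs_pos | lra].
Qed.

Lemma cpow_derive t z : (0 < t)%R ->
  is_derive (fun s => Re (cpow_pos s z)) t (Re (z * cpow_pos t (z - 1))) /\
  is_derive (fun s => Im (cpow_pos s z)) t (Im (z * cpow_pos t (z - 1))).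
Proof.
intros Ht.
assert (E : cpow_pos t (z - 1) = cpow_pos t z * RtoC (/ t)).
{ rewrite RtoC_inv by lra.
  replace (cpow_pos t z) with (cpow_pos t (z - 1) * cpow_pos t 1)
    by (rewrite <- cpow_plus; f_equal; ring).
  rewrite cpow_exp1 by exact Ht; field; apply RtoC_neq_0; lra. }
rewrite E; unfold cpow_pos, Re, Im; simpl; split; auto_derive; auto; simpl; field; lra.
Qed.

(** Two mean value theorems, for [f1] and then for [f]; this loses the factor 1/2 of the sharp
    remainder. *)
Lemma taylor2_bound (f f1 f2 : R -> R) (M h : R) :
  (0 <= h <= 1)%R ->
  (forall x, (0 <= x <= 1)%R -> is_derive f x (f1 x)) ->
  (forall x, (0 <= x <= 1)%R -> is_derive f1 x (f2 x)) ->
  (forall x, (0 <= x <= 1)%R -> (Rabs (f2 x) <= M)%R) ->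
  f 0%R = 0%R -> f1 0%R = 0%R -> (Rabs (f h) <= M * h ^ 2)%R.
Proof.
intros Hh D1 D2 B F0 F1.
assert (H1 : forall x, (0 <= x <= h)%R -> (Rabs (f1 x) <= M * x)%R).
{ intros x Hx.
  destruct (MVT_gen f1 0 x f2) as (c & Hc & E).
  - intros y Hy; rewrite Rmin_left, Rmax_right in Hy by lra; apply D2; lra.
  - intros y Hy; rewrite Rmin_left, Rmax_right in Hy by lra.
    apply continuity_pt_filterlim, (ex_derive_continuous f1).
    eexists; apply D2; lra.
  - rewrite Rmin_left, Rmax_right in Hc by lra.
    rewrite F1, !Rminus_0_r in E; rewrite E, Rabs_mult, (Rabs_pos_eq x) by lra.
    apply Rmult_le_compat_r; [lra | apply B; lra]. }
destruct (MVT_gen f 0 h f1) as (c & Hc & E).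
- intros y Hy; rewrite Rmin_left, Rmax_right in Hy by lra; apply D1; lra.
- intros y Hy; rewrite Rmin_left, Rmax_right in Hy by lra.
  apply continuity_pt_filterlim, (ex_derive_continuous f).
  eexists; apply D1; lra.
- rewrite Rmin_left, Rmax_right in Hc by lra.
  rewrite F0, !Rminus_0_r in E; rewrite E, Rabs_mult, (Rabs_pos_eq h) by lra.
  specialize (H1 c Hc).
  assert (M0 : (0 <= M)%R) by (apply Rle_trans with (2 := B 0%R ltac:(lra)), Rabs_pos).
  apply Rle_trans with (M * h * h)%R; [|right; ring].
  apply Rmult_le_compat_r; [lra|].
  apply Rle_trans with (1 := H1), Rmult_le_compat_l; lra.
Qed.

Lemma cpow_taylor z : exists K : R, (0 <= K)%R /\ forall h : R, (0 <= h <= 1)%R ->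
  (Cmod (cpow_pos (1 + h) z - 1 - z * RtoC h) <= K * h ^ 2)%R.
Proof.
(* [M] bounds the second derivative [z (z-1) (1+x)^(z-2)] on [[0, 1]]. The final constant is [M + M]
   because real and imaginary parts are estimated separately. *)
set (M := (Cmod (z * (z - 1)) * exp (Rabs (Re (z - 1 - 1)) * ln 2))%R).
assert (M0 : (0 <= M)%R)
  by (apply Rmult_le_pos; [apply Cmod_ge_0 | left; apply exp_pos]).
exists (M + M)%R; split; [lra|]; intros h Hh.
assert (D : forall w x, (0 <= x <= 1)%R ->
  is_derive (fun x => Re (cpow_pos (1 + x) w)) x (Re (w * cpow_pos (1 + x) (w - 1))) /\
  is_derive (fun x => Im (cpow_pos (1 + x) w)) x (Im (w * cpow_pos (1 + x) (w - 1)))).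
{ intros w x Hx; destruct (cpow_derive (1 + x) w ltac:(lra)) as [P Q].
  assert (A : is_derive (fun x : R => (1 + x)%R) x 1%R)
    by (auto_derive; auto; ring).
  split.
  - assert (T := is_derive_comp (fun s => Re (cpow_pos s w)) (fun x : R => (1 + x)%R)
        x _ _ P A); rewrite (scal_one (V := R_NormedModule)) in T; exact T.
  - assert (T := is_derive_comp (fun s => Im (cpow_pos s w)) (fun x : R => (1 + x)%R)
        x _ _ Q A); rewrite (scal_one (V := R_NormedModule)) in T; exact T. }
assert (B : forall x, (0 <= x <= 1)%R ->
  (Cmod (z * ((z - 1) * cpow_pos (1 + x) (z - 1 - 1))) <= M)%R).
{ intros x Hx; replace (z * ((z - 1) * cpow_pos (1 + x) (z - 1 - 1)))
    with (z * (z - 1) * cpow_pos (1 + x) (z - 1 - 1)) by ring.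
  rewrite Cmod_mult; apply Rmult_le_compat_l; [apply Cmod_ge_0|].
  apply Cmod_cpow_le; lra. }
eapply Rle_trans; [apply Cmod_le_Re_Im|].
rewrite Rmult_plus_distr_r; apply Rplus_le_compat.
- apply (taylor2_bound
    (fun h => Re (cpow_pos (1 + h) z - 1 - z * RtoC h))
    (fun h => Re (z * cpow_pos (1 + h) (z - 1)) - Re z)%R
    (fun h => Re (z * ((z - 1) * cpow_pos (1 + h) (z - 1 - 1))))); try assumption.
  + intros x Hx; destruct (D z x Hx) as [P _].
    apply is_derive_ext with (fun h => minus (Re (cpow_pos (1 + h) z)) (1 + Re z * h)%R).
    { intros t; rewrite !Re_minus, re_scal_r; unfold minus, plus, opp; simpl; ring. }
    apply (is_derive_minus (fun h => Re (cpow_pos (1 + h) z)) (fun h => (1 + Re z * h)%R));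
      [exact P|]. auto_derive; auto; ring.
  + intros x Hx; destruct (D (z - 1) x Hx) as [P Q].
    set (a := fun h => Re (cpow_pos (1 + h) (z - 1))) in *.
    set (b := fun h => Im (cpow_pos (1 + h) (z - 1))) in *.
    apply is_derive_ext with (fun h => (Re z * a h - Im z * b h - Re z)%R); [reflexivity|].
    auto_derive; [repeat split; eexists; eassumption|].
    replace (Derive _ x) with (Re ((z - 1) * cpow_pos (1 + x) (z - 1 - 1)))
      by (symmetry; apply is_derive_unique, P).
    replace (Derive _ x) with (Im ((z - 1) * cpow_pos (1 + x) (z - 1 - 1)))
      by (symmetry; apply is_derive_unique, Q).
    rewrite (re_mult z); ring.
  + intros x Hx; eapply Rle_trans; [apply re_le_Cmod | apply B, Hx].
  + rewrite Rplus_0_r, cpow_base1; unfold Re, Im; simpl; ring.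
  + rewrite Rplus_0_r, cpow_base1; unfold Re, Im; simpl; ring.
- apply (taylor2_bound
    (fun h => Im (cpow_pos (1 + h) z - 1 - z * RtoC h))
    (fun h => Im (z * cpow_pos (1 + h) (z - 1)) - Im z)%R
    (fun h => Im (z * ((z - 1) * cpow_pos (1 + h) (z - 1 - 1))))); try assumption.
  + intros x Hx; destruct (D z x Hx) as [_ P].
    apply is_derive_ext with (fun h => minus (Im (cpow_pos (1 + h) z)) (Im z * h)%R).
    { intros t; rewrite !Im_minus, im_scal_r; unfold minus, plus, opp; simpl; ring. }
    apply (is_derive_minus (fun h => Im (cpow_pos (1 + h) z)) (fun h => (Im z * h)%R));
      [exact P|]. auto_derive; auto; ring.
  + intros x Hx; destruct (D (z - 1) x Hx) as [P Q].
    set (a := fun h => Re (cpow_pos (1 + h) (z - 1))) in *.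
    set (b := fun h => Im (cpow_pos (1 + h) (z - 1))) in *.
    apply is_derive_ext with (fun h => (Re z * b h + Im z * a h - Im z)%R); [reflexivity|].
    auto_derive; [repeat split; eexists; eassumption|].
    replace (Derive _ x) with (Im ((z - 1) * cpow_pos (1 + x) (z - 1 - 1)))
      by (symmetry; apply is_derive_unique, Q).
    replace (Derive _ x) with (Re ((z - 1) * cpow_pos (1 + x) (z - 1 - 1)))
      by (symmetry; apply is_derive_unique, P).
    rewrite (im_mult z); ring.
  + intros x Hx; eapply Rle_trans; [apply im_le_Cmod | apply B, Hx].
  + rewrite Rplus_0_r, cpow_base1; unfold Re, Im; simpl; ring.
  + rewrite Rplus_0_r, cpow_base1; unfold Re, Im; simpl; ring.
Qed.

(** * The Gamma function *)

(** The right side is [2 / ((n+1) (n+2))], and [n + 2 <= 2 (n + 1)]. The telescoping form provides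
    monotone corrections in the next two convergence proofs. *)
Lemma inv_sq_telescope (n : nat) :
  (/ (INR n + 1) ^ 2 <= 2 / (INR n + 1) - 2 / (INR n + 1 + 1))%R.
Proof.
assert (H := pos_INR n).
replace (2 / (INR n + 1) - 2 / (INR n + 1 + 1))%R
  with (2 / ((INR n + 1) * (INR n + 1 + 1)))%R by (field; lra).
apply Rle_div_r; [nra|].
apply Rle_trans with (/ (INR n + 1) ^ 2 * (2 * (INR n + 1) ^ 2))%R.
- apply Rmult_le_compat_l; [|nra]. left; apply Rinv_0_lt_compat; nra.
- right; field; lra.
Qed.

Lemma seq_cvg_inv_sq (r : nat -> R) (K B : R) :
  (forall n, (Rabs (r (S n) - r n) <= K / (INR n + 1) ^ 2)%R) ->
  (forall n, (Rabs (r n) <= B)%R) -> (0 <= K)%R -> ex_finite_lim_seq r.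
Proof.
intros H HB HK.
(* Chosen so that [r - c] is nondecreasing: a drop of [r] by [K / (n+1)^2] is compensated by the
   decrease of [c]. *)
set (c := fun n => (2 * K / (INR n + 1))%R).
assert (C0 : is_lim_seq c 0%R).
{ apply is_lim_seq_ext with (fun n => (2 * K * / INR (S n))%R).
  { intros n; unfold c; rewrite S_INR; reflexivity. }
  replace 0%R with (2 * K * 0)%R by ring.
  apply is_lim_seq_mult'; [apply is_lim_seq_const|].
  apply (is_lim_seq_incr_1 (fun n => (/ INR n)%R)).
  replace (Finite 0) with (Rbar_inv p_infty) by reflexivity.
  apply is_lim_seq_inv; [apply is_lim_seq_INR | discriminate]. }
destruct (ex_finite_lim_seq_incr (fun n => (r n - c n)%R) B) as [l Hl].
- intros n; specialize (H n); assert (T := inv_sq_telescope n).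
  unfold c; rewrite S_INR.
  apply Rmult_le_compat_l with (r := K) in T; [|exact HK].
  unfold Rdiv in *; apply Rabs_le_between in H; lra.
- intros n; specialize (HB n); apply Rabs_le_between in HB.
  assert (0 <= c n)%R.
  { unfold c; assert (h := pos_INR n); apply Rdiv_le_0_compat; lra. }
  lra.
- exists (l + 0)%R.
  apply is_lim_seq_ext with (fun n => ((r n - c n) + c n)%R); [intros; ring|].
  apply is_lim_seq_plus'; assumption.
Qed.

Lemma product_cvg (p u : nat -> C) (K : R) :
  (forall n, p (S n) = p n * (1 + u n)) ->
  (forall n, (Cmod (u n) <= K / (INR n + 1) ^ 2)%R) -> exists l, clim p l.
Proof.
intros Hp Hu.
assert (HK : (0 <= K)%R).
{ assert (T := Hu O); simpl in T; assert (T0 := Cmod_ge_0 (u O)); lra. }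
(* The left side is nonincreasing in [n]: its exponential shrinks by at least the factor
   [exp (K / (n+1)^2)] that bounds [Cmod (1 + u n)]. *)
assert (HB : forall n, (Cmod (p n) * exp (K * (2 / (INR n + 1)))
                        <= Cmod (p O) * exp (K * 2))%R).
{ induction n as [|n IH].
  - simpl; right; do 3 f_equal; field.
  - apply Rle_trans with (2 := IH).
    rewrite Hp, Cmod_mult, Rmult_assoc.
    apply Rmult_le_compat_l; [apply Cmod_ge_0|].
    apply Rle_trans with (exp (K / (INR n + 1) ^ 2) * exp (K * (2 / (INR (S n) + 1))))%R.
    + apply Rmult_le_compat_r; [left; apply exp_pos|].
      assert (T := Cmod_triangle 1 (u n)); rewrite Cmod_1 in T.
      specialize (Hu n); assert (E := exp_ineq1_le (K / (INR n + 1) ^ 2)); lra.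
    + rewrite <- exp_plus; apply exp_le_mono; rewrite S_INR.
      assert (T := inv_sq_telescope n).
      apply Rmult_le_compat_l with (r := K) in T; [|exact HK].
      unfold Rdiv in *; lra. }
set (B := (Cmod (p O) * exp (K * 2))%R) in *.
assert (HB' : forall n, (Cmod (p n) <= B)%R).
{ intros n; apply Rle_trans with (2 := HB n).
  rewrite <- (Rmult_1_r (Cmod (p n))) at 1.
  apply Rmult_le_compat_l; [apply Cmod_ge_0|].
  apply Rle_trans with (exp 0); [rewrite exp_0; lra | apply exp_le_mono].
  assert (h := pos_INR n); apply Rmult_le_pos; [exact HK|].
  apply Rdiv_le_0_compat; lra. }
assert (B0 : (0 <= B)%R) by (apply Rle_trans with (2 := HB' O), Cmod_ge_0).
assert (HD : forall n, (Cmod (p (S n) - p n) <= B * K / (INR n + 1) ^ 2)%R).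
{ intros n; rewrite Hp; replace (p n * (1 + u n) - p n) with (p n * u n) by ring.
  rewrite Cmod_mult; unfold Rdiv; rewrite Rmult_assoc.
  apply Rmult_le_compat; [apply Cmod_ge_0 | apply Cmod_ge_0 | apply HB' | apply Hu]. }
assert (BK : (0 <= B * K)%R) by (apply Rmult_le_pos; assumption).
destruct (seq_cvg_inv_sq (fun n => Re (p n)) (B * K) B) as [lr Hr]; auto.
{ intros n; rewrite <- Re_minus; eapply Rle_trans; [apply re_le_Cmod | apply HD]. }
{ intros n; eapply Rle_trans; [apply re_le_Cmod | apply HB']. }
destruct (seq_cvg_inv_sq (fun n => Im (p n)) (B * K) B) as [li Hi]; auto.
{ intros n; rewrite <- Im_minus; eapply Rle_trans; [apply im_le_Cmod | apply HD]. }
{ intros n; eapply Rle_trans; [apply im_le_Cmod | apply HB']. }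
exists (lr, li); split; assumption.
Qed.

Lemma clim_incr_n u N l : clim (fun n => u (n + N)%nat) l <-> clim u l.
Proof.
unfold clim; rewrite <- (is_lim_seq_incr_n (fun n => Re (u n)) N).
rewrite <- (is_lim_seq_incr_n (fun n => Im (u n)) N); reflexivity.
Qed.

Lemma product_cvg_ev (p u : nat -> C) (K : R) (N : nat) :
  (forall n, p (S n) = p n * (1 + u n)) ->
  (forall n, (N <= n)%nat -> (Cmod (u n) <= K / (INR n + 1) ^ 2)%R) ->
  exists l, clim p l.
Proof.
intros Hp Hu.
destruct (product_cvg (fun n => p (n + N)%nat) (fun n => u (n + N)%nat) K) as [l Hl].
- intros n; apply Hp.
- intros n; eapply Rle_trans; [apply Hu; lia|].
  rewrite plus_INR; assert (h := pos_INR n); assert (h' := pos_INR N).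
  assert (HK : (0 <= K)%R).
  { assert (T := Hu N (le_n _)); assert (T0 := Cmod_ge_0 (u N)).
    assert (T1 : (0 <= K / (INR N + 1) ^ 2)%R) by lra.
    apply Rmult_le_compat_r with (r := ((INR N + 1) ^ 2)%R) in T1; [|nra].
    replace (K / (INR N + 1) ^ 2 * (INR N + 1) ^ 2)%R with K in T1 by (field; lra).
    lra. }
  apply Rmult_le_compat_l; [exact HK|].
  apply Rinv_le_contravar; [|apply pow_incr]; [nra|lra].
- exists l; apply clim_incr_n with N, Hl.
Qed.

Lemma clim_unique u a b : clim u a -> clim u b -> a = b.
Proof.
intros [H1 H2] [H3 H4].
apply is_lim_seq_unique in H1, H2, H3, H4.
rewrite H1 in H3; rewrite H2 in H4; injection H3; injection H4; intros.
rewrite (surjective_pairing a), (surjective_pairing b); f_equal; assumption.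
Qed.

(** The factor by which [n^z] grows from [n = k + 1] to [n = k + 2]. Index 0 is left out because
    [ln 0] is only a default value. *)
Definition gamma_step (z : C) (k : nat) : C := cpow_pos (1 + / INR (S k)) z.

Lemma euler_gamma_neq_0 z n : not_npint z -> euler_gamma_seq z n <> 0.
Proof.
intros Hz; unfold euler_gamma_seq, Cdiv.
apply Cmult_neq_0.
- apply Cmult_neq_0; [apply fact_neq_0C | apply cpow_neq_0].
- intros E; apply C1_nz; rewrite <- (Cinv_r (poch z (S n))), E; [ring|].
  apply npint_poch_neq_0, Hz.
Qed.

Lemma euler_gamma_step z k : not_npint z ->
  euler_gamma_seq z (S (S k)) * (1 + z / (RtoC (INR (S k)) + 1))
  = euler_gamma_seq z (S k) * gamma_step z k.
Proof.
intros Hz; unfold euler_gamma_seq, gamma_step.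
assert (Hk : (0 < INR (S k))%R) by (apply lt_0_INR; lia).
replace (INR (S (S k))) with (INR (S k) * (1 + / INR (S k)))%R
  by (rewrite (S_INR (S k)); field; lra).
assert (Hk2 : (0 < / INR (S k))%R) by (apply Rinv_0_lt_compat, Hk).
rewrite cpow_mult_base by lra.
rewrite fact_S_C.
change (poch z (S (S (S k)))) with (poch z (S (S k)) * (z + RtoC (INR (S (S k))))).
assert (H1 := npint_poch_neq_0 z (S (S k)) Hz).
assert (H2 := not_npint_plus z (S (S k)) Hz).
rewrite (RtoC_S (S k)) in *.
assert (H3 := S_neq_0 (S k)).
field; repeat split; auto.
Qed.

(* The successive quotients of the Euler-Gauss sequence, and their inverses,
   are [1 + O(1/n^2)], so both the sequence and its inverse converge. *)
Lemma euler_gamma_cvg z : not_npint z ->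
  exists l : C, l <> 0 /\ clim (euler_gamma_seq z) l.
Proof.
intros Hz.
destruct (cpow_taylor z) as (K & HK & HT).
set (w := fun k => z / (RtoC (INR (S k)) + 1)).
assert (W0 : forall k, 1 + w k <> 0).
{ intros k E; apply (not_npint_plus z (S (S k)) Hz); rewrite (RtoC_S (S k)).
  replace (z + (RtoC (INR (S k)) + 1)) with ((1 + w k) * (RtoC (INR (S k)) + 1))
    by (unfold w; field; apply S_neq_0).
  rewrite E; ring. }
assert (A0 : forall k, gamma_step z k <> 0) by (intros; apply cpow_neq_0).
assert (G0 : forall k, euler_gamma_seq z k <> 0)
  by (intros; apply euler_gamma_neq_0, Hz).
assert (ST := fun k => euler_gamma_step z k Hz).
(* The linear Taylor term of the step is [z / (k+1)], while [w k] is [z / (k+2)]; their difference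
   [z / ((k+1) (k+2))] is again of second order. *)
assert (HD : forall k, (Cmod (gamma_step z k - (1 + w k))
                        <= (K + Cmod z) / (INR k + 1) ^ 2)%R).
{ intros k.
  assert (Hk := pos_INR k).
  assert (H1 : (0 <= / INR (S k) <= 1)%R).
  { rewrite S_INR; split; [left; apply Rinv_0_lt_compat; lra|].
    rewrite <- Rinv_1; apply Rinv_le_contravar; lra. }
  specialize (HT _ H1).
  replace (gamma_step z k - (1 + w k)) with
    ((gamma_step z k - 1 - z * RtoC (/ INR (S k)))
     + z * RtoC (/ (INR (S k) * (INR (S k) + 1)))).
  - eapply Rle_trans; [apply Cmod_triangle|].
    unfold Rdiv; rewrite Rmult_plus_distr_r; apply Rplus_le_compat.
    + apply Rle_trans with (1 := HT); rewrite S_INR, pow_inv; right; reflexivity.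
    + rewrite Cmod_mult; apply Rmult_le_compat_l; [apply Cmod_ge_0|].
      rewrite Cmod_R, S_INR, Rabs_pos_eq by (left; apply Rinv_0_lt_compat; nra).
      apply Rinv_le_contravar; nra.
  - unfold w; rewrite !RtoC_inv by (rewrite S_INR; nra).
    rewrite RtoC_mult, RtoC_plus; field.
    split; [apply S_neq_0 |]. rewrite RtoC_S; apply S_neq_0. }
set (Q := (K + Cmod z)%R) in *.
assert (Q0 : (0 <= Q)%R) by (unfold Q; assert (T := Cmod_ge_0 z); lra).
assert (HW : exists N, forall k, (N <= k)%nat -> (Cmod (/ (1 + w k)) <= 2)%R).
{ assert (CW : clim (fun k => w k) 0).
  { apply clim_ext with (fun k => z * / (1 + RtoC (INR (S k)))).
    - intros k; unfold w, Cdiv; do 2 f_equal; ring.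
    - apply clim_eq with (z * 0); [|ring]; apply clim_mult; [apply clim_const|].
      apply (clim_incr_1 (fun k => / (1 + RtoC (INR k)))), clim_inv_shift. }
  rewrite clim_spec in CW; destruct (CW (/ 2)%R ltac:(lra)) as [N h].
  exists N; intros k Hk; specialize (h k Hk).
  replace (w k - 0) with (w k) in h by ring.
  assert (T := Cmod_triangle (1 + w k) (- w k)).
  replace (1 + w k + - w k) with (RtoC 1) in T by ring.
  rewrite Cmod_1, Cmod_opp in T.
  rewrite Cmod_inv by apply W0.
  rewrite <- (Rinv_inv 2); apply Rinv_le_contravar; lra. }
destruct HW as [N HW].
destruct (product_cvg_ev (fun k => euler_gamma_seq z (S k))
  (fun k => (gamma_step z k - (1 + w k)) * / (1 + w k)) (Q * 2) N) as [l Hl].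
{ intros k.
  replace (1 + (gamma_step z k - (1 + w k)) * / (1 + w k))
    with (gamma_step z k / (1 + w k)) by (field; apply W0).
  unfold Cdiv; rewrite Cmult_assoc, <- ST; fold (w k); field; apply W0. }
{ intros k Hk; rewrite Cmod_mult.
  replace (Q * 2 / (INR k + 1) ^ 2)%R with (Q / (INR k + 1) ^ 2 * 2)%R
    by (unfold Rdiv; ring).
  apply Rmult_le_compat; auto using Cmod_ge_0. }
destruct (product_cvg_ev (fun k => / euler_gamma_seq z (S k))
  (fun k => - (gamma_step z k - (1 + w k)) * / gamma_step z k)
  (Q * exp (Rabs (Re (- z)) * ln 2)) O) as [l' Hl'].
{ intros k.
  replace (1 + - (gamma_step z k - (1 + w k)) * / gamma_step z k)
    with ((1 + w k) / gamma_step z k) by (field; apply A0).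
  replace (gamma_step z k) with
    (euler_gamma_seq z (S (S k)) * (1 + w k) / euler_gamma_seq z (S k))
    by (unfold w; rewrite ST; field; apply G0).
  field; repeat split; auto. }
{ intros k _; rewrite Cmod_mult, Cmod_opp.
  replace (Q * exp (Rabs (Re (- z)) * ln 2) / (INR k + 1) ^ 2)%R
    with (Q / (INR k + 1) ^ 2 * exp (Rabs (Re (- z)) * ln 2))%R
    by (unfold Rdiv; ring).
  apply Rmult_le_compat; auto using Cmod_ge_0.
  replace (/ gamma_step z k) with (cpow_pos (1 + / INR (S k)) (- z)).
  - apply Cmod_cpow_le; assert (Hk := pos_INR k); rewrite S_INR.
    assert (0 < / (INR k + 1))%R by (apply Rinv_0_lt_compat; lra).
    assert (/ (INR k + 1) <= / 1)%R by (apply Rinv_le_contravar; lra); lra.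
  - assert (E : gamma_step z k * cpow_pos (1 + / INR (S k)) (- z) = 1).
    { unfold gamma_step; rewrite <- cpow_plus.
      replace (z + - z) with (RtoC 0) by ring; apply cpow_exp0. }
    replace (/ gamma_step z k) with
      (gamma_step z k * cpow_pos (1 + / INR (S k)) (- z) * / gamma_step z k)
      by (rewrite E; ring).
    field; apply A0. }
exists l; split.
(* The sequence times its inverse is constantly 1, so a zero limit would give [1 = 0 * l']. *)
- intros E; subst l.
  assert (E1 := clim_mult _ _ _ _ Hl Hl').
  apply C1_nz; apply (clim_unique (fun _ => 1)); [apply clim_const|].
  apply clim_eq with (0 * l'); [|ring].
  apply clim_ext with (2 := E1); intros k; field; apply G0.
- apply (clim_incr_n (euler_gamma_seq z) 1).
  apply clim_ext with (2 := Hl); intros k; rewrite Nat.add_1_r; reflexivity.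
Qed.

Lemma CGamma_clim z l : clim (euler_gamma_seq z) l -> CGamma z = l.
Proof.
intros [H1 H2]; unfold CGamma.
rewrite (is_lim_seq_unique _ _ H1), (is_lim_seq_unique _ _ H2).
symmetry; apply surjective_pairing.
Qed.

Lemma CGamma_neq_0 z : not_npint z -> CGamma z <> 0.
Proof.
intros Hz; destruct (euler_gamma_cvg z Hz) as (l & Hl & H).
rewrite (CGamma_clim z l H); exact Hl.
Qed.

(** The Euler-Gauss quotient at [z + 1] is the one at [z] times [z n / (z + 1 + n)], which tends to
    [z]. Shifting [n] by one avoids powers of 0. *)
Lemma CGamma_S z : not_npint z -> CGamma (z + 1) = z * CGamma z.
Proof.
intros Hz; destruct (euler_gamma_cvg z Hz) as (l & _ & H).
rewrite (CGamma_clim z l H); apply CGamma_clim.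
apply (clim_incr_n _ 1).
apply clim_ext with (fun n => z * euler_gamma_seq z (n + 1)
    * ((0 + RtoC (INR (n + 1))) / (z + 1 + RtoC (INR (n + 1))))).
- intros n; unfold euler_gamma_seq.
  rewrite cpow_plus, cpow_exp1 by (apply lt_0_INR; lia).
  assert (Z0 : z <> 0).
  { intros E; apply (not_npint_plus z 0 Hz); rewrite E; simpl; ring. }
  assert (H1 := npint_poch_neq_0 (z + 1) (n + 1) (not_npint_S _ Hz)).
  assert (H2 := not_npint_plus (z + 1) (n + 1) (not_npint_S _ Hz)).
  rewrite (poch_S_l z); simpl poch; field; auto.
- apply clim_eq with (z * l * 1); [|ring].
  apply clim_mult.
  + apply clim_mult; [apply clim_const|].
    apply (clim_incr_n (euler_gamma_seq z) 1), H.
  + apply (clim_incr_n (fun n => (0 + RtoC (INR n)) / (z + 1 + RtoC (INR n))) 1).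
    apply clim_shift_ratio, not_npint_S, Hz.
Qed.

Lemma CGamma_poch z n : not_npint z ->
  CGamma (z + RtoC (INR n)) = poch z n * CGamma z.
Proof.
intros Hz; induction n as [|n IH].
- simpl; rewrite Cplus_0_r; ring.
- rewrite RtoC_S, Cplus_assoc, CGamma_S, IH by (apply not_npint_INR, Hz).
  simpl; ring.
Qed.

(** * Abel means and the binomial series *)

Section RealAbel.
Local Open Scope R_scope.

(** Dividing by [x] undoes an index shift, which loses nothing because the constant term is zero. *)
Lemma is_series_difference (u : nat -> R) (x s : R) : 0 < x -> u O = 0 ->
  is_series (fun n => u n * x ^ n) s ->
  is_series (fun n => (u (S n) - u n) * x ^ n) ((1 - x) / x * s).
Proof.
intros Hx U0 Hs.
assert (H1 : is_series (fun n => u (S n) * x ^ S n) s).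
{ apply (is_series_incr_1 (fun n => u n * x ^ n)).
  replace (plus s _) with s by (rewrite U0; unfold plus; simpl; ring).
  exact Hs. }
apply (is_series_scal (/ x)) in H1.
assert (H2 := is_series_minus _ _ _ _ H1 Hs).
replace ((1 - x) / x * s) with (minus (scal (/ x) s) s).
- eapply is_series_ext; [|exact H2]; intros n.
  unfold minus, plus, opp, scal; simpl; unfold mult; simpl; field; lra.
- unfold minus, plus, opp, scal; simpl; unfold mult; simpl; field; lra.
Qed.

(** The ratio test gives convergence; differencing the coefficients [n] yields the geometric series,
    hence a linear equation for the sum. *)
Lemma is_series_arith_geom (x : R) : 0 < x < 1 ->
  is_series (fun n => (INR n + 1) * x ^ n) (/ (1 - x) ^ 2).
Proof.
intros Hx.
assert (Hex : ex_series (fun n => (INR n + 1) * x ^ n)).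
{ apply ex_series_Rabs, ex_series_DAlembert with x; [lra| |].
  - intros n; assert (h := pos_INR n).
    apply Rmult_integral_contrapositive_currified; [lra|apply pow_nonzero; lra].
  - apply is_lim_seq_ext with (fun n => x * (1 + / INR (S n))).
    + intros n; assert (h := pos_INR n); rewrite S_INR.
      assert (P : x ^ n <> 0) by (apply pow_nonzero; lra).
      replace ((INR n + 1 + 1) * x ^ S n / ((INR n + 1) * x ^ n))
        with (x * (1 + / (INR n + 1))) by (simpl; field; lra).
      symmetry; apply Rabs_pos_eq.
      apply Rmult_le_pos; [lra|].
      assert (0 < / (INR n + 1)) by (apply Rinv_0_lt_compat; lra); lra.
    + replace (Finite x) with (Finite (x * (1 + 0))) by (f_equal; ring).
      apply is_lim_seq_mult'; [apply is_lim_seq_const|].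
      apply is_lim_seq_plus'; [apply is_lim_seq_const|].
      apply (is_lim_seq_incr_1 (fun n => / INR n)).
      replace (Finite 0) with (Rbar_inv p_infty) by reflexivity.
      apply is_lim_seq_inv; [apply is_lim_seq_INR | discriminate]. }
assert (Hg : is_series (fun n => x ^ n) (/ (1 - x)))
  by (apply is_series_geom; rewrite Rabs_pos_eq; lra).
destruct Hex as [s Hs].
assert (Hn : is_series (fun n => INR n * x ^ n) (s - / (1 - x))).
{ eapply is_series_ext; [|apply (is_series_minus _ _ _ _ Hs Hg)]; intros n.
  unfold minus, plus, opp; simpl; ring. }
assert (Hd := is_series_difference INR x _ (proj1 Hx) eq_refl Hn).
assert (E : (1 - x) / x * (s - / (1 - x)) = / (1 - x)).
{ rewrite <- (is_series_unique _ _ Hd), <- (is_series_unique _ _ Hg).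
  apply Series_ext; intros n; rewrite S_INR; ring. }
replace (/ (1 - x) ^ 2) with s; [exact Hs|].
change (@eq R s (/ (1 - x) ^ 2)).
replace s with ((1 - x) / x * (s - / (1 - x)) * (x / (1 - x)) + / (1 - x))
  by (field; lra).
rewrite E; field; lra.
Qed.

Lemma eventually_bounded (f : nat -> R) (N : nat) :
  (forall n, (N <= n)%nat -> f n <= 0) -> exists K, 0 <= K /\ forall n, f n <= K.
Proof.
intros H; destruct (cbounded_ev (fun n => RtoC (Rmax 0 (f n))) 0 N) as [K HK].
- intros n Hn; rewrite Rmax_left by auto; rewrite Cmod_0; lra.
- assert (HK' : forall n, Rmax 0 (f n) <= K).
  { intros n; specialize (HK n); rewrite Cmod_R in HK.
    eapply Rle_trans; [apply Rle_abs | exact HK]. }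
  exists K; split; [eapply Rle_trans; [|apply (HK' O)]; apply Rmax_l|].
  intros n; eapply Rle_trans; [|apply (HK' n)]; apply Rmax_r.
Qed.

(** Differencing twice gives [sum d_n x^n = ((1-x)/x)^2 sum A_n x^n]. The main part [(n+1) L] of [A]
    contributes [L / x^2], and an error of size [e (n+1) + K] contributes at most
    [(e + K (1-x)) / x^2]. *)
Lemma abel_cesaro (A D d : nat -> R) (L : R) :
  A O = 0 -> D O = 0 -> (forall n, A (S n) = A n + D n) ->
  (forall n, D (S n) = D n + d n) ->
  (forall eps, 0 < eps -> exists N, forall n, (N <= n)%nat ->
     Rabs (A n - (INR n + 1) * L) <= eps * (INR n + 1)) ->
  forall eps, 0 < eps -> exists delta, 0 < delta /\
    forall x, 1 - delta < x < 1 ->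
      exists s, is_series (fun n => d n * x ^ n) s /\ Rabs (s - L) < eps.
Proof.
intros A0 D0 HA HD HL eps He.
destruct (HL (eps / 16) ltac:(lra)) as [N hN].
set (E := fun n => A n - (INR n + 1) * L) in *.
destruct (eventually_bounded (fun n => Rabs (E n) - eps / 16 * (INR n + 1)) N)
  as (K & K0 & HK).
{ intros n Hn; specialize (hN n Hn); fold (E n) in hN; lra. }
(* For [x > 1/2] the division by [x^2] costs a factor 4. [Q] is 4 times the coefficient [2 |L| + K]
   of [1 - x] in the error, plus 1 for positivity. *)
set (Q := 8 * Rabs L + 4 * K + 1).
assert (Q0 : 0 < Q) by (unfold Q; assert (T := Rabs_pos L); lra).
exists (Rmin (/ 2) (eps / (2 * Q))); split.
{ apply Rmin_glb_lt; [lra|]. apply Rdiv_lt_0_compat; lra. }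
intros x Hx.
assert (Hx1 : / 2 < x < 1).
{ assert (T := Rmin_l (/ 2) (eps / (2 * Q))); lra. }
assert (Hx2 : 1 - x < eps / (2 * Q)).
{ assert (T := Rmin_r (/ 2) (eps / (2 * Q))); lra. }
assert (Hx0 : 0 < x < 1) by lra.
assert (Hag := is_series_arith_geom x Hx0).
assert (Hg : is_series (fun n => x ^ n) (/ (1 - x)))
  by (apply is_series_geom; rewrite Rabs_pos_eq; lra).
assert (Hb : is_series (fun n => (eps / 16 * (INR n + 1) + K) * x ^ n)
   (eps / 16 * / (1 - x) ^ 2 + K * / (1 - x))).
{ eapply is_series_ext; [|apply (is_series_plus _ _ _ _
     (is_series_scal (eps / 16) _ _ Hag) (is_series_scal K _ _ Hg))]; intros n.
  unfold plus, scal; simpl; unfold mult; simpl; ring. }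
assert (Hle : forall n, Rabs (E n * x ^ n) <= (eps / 16 * (INR n + 1) + K) * x ^ n).
{ intros n; assert (P : 0 < x ^ n) by (apply pow_lt; lra).
  rewrite Rabs_mult, (Rabs_pos_eq (x ^ n)) by lra.
  apply Rmult_le_compat_r; [lra|]; specialize (HK n); simpl in HK; lra. }
assert (Hea : ex_series (fun n => Rabs (E n * x ^ n))).
{ apply (ex_series_le (K := R_AbsRing) (V := R_CompleteNormedModule) _
    (fun n => (eps / 16 * (INR n + 1) + K) * x ^ n)); [|eexists; exact Hb].
  intros n; unfold norm; simpl; unfold abs; simpl; rewrite Rabs_Rabsolu; apply Hle. }
destruct (ex_series_Rabs _ Hea) as [sE HE].
assert (HsE : Rabs sE <= eps / 16 * / (1 - x) ^ 2 + K * / (1 - x)).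
{ rewrite <- (is_series_unique _ _ HE), <- (is_series_unique _ _ Hb).
  eapply Rle_trans; [apply Series_Rabs, Hea|].
  apply Series_le; [|eexists; exact Hb].
  intros n; split; [apply Rabs_pos | apply Hle]. }
assert (HsA : is_series (fun n => A n * x ^ n) (L * / (1 - x) ^ 2 + sE)).
{ eapply is_series_ext; [|apply (is_series_plus _ _ _ _
     (is_series_scal L _ _ Hag) HE)]; intros n.
  unfold plus, scal, E; simpl; unfold mult; simpl; ring. }
apply is_series_difference in HsA; [|lra|exact A0].
apply (is_series_ext _ (fun n => D n * x ^ n)) in HsA.
2:{ intros n; rewrite HA; simpl; ring. }
apply is_series_difference in HsA; [|lra|exact D0].
apply (is_series_ext _ (fun n => d n * x ^ n)) in HsA.
2:{ intros n; rewrite HD; simpl; ring. }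
eexists; split; [exact HsA|].
replace ((1 - x) / x * ((1 - x) / x * (L * / (1 - x) ^ 2 + sE)) - L)
  with ((L * (1 - x) * (1 + x) + (1 - x) ^ 2 * sE) / x ^ 2) by (field; lra).
assert (X2 : / 4 < x ^ 2) by (simpl; nra).
assert (NN : Rabs (L * (1 - x) * (1 + x) + (1 - x) ^ 2 * sE)
  <= 2 * Rabs L * (1 - x) + (eps / 16 + K * (1 - x))).
{ eapply Rle_trans; [apply Rabs_triang|]; apply Rplus_le_compat.
  - rewrite !Rabs_mult, (Rabs_pos_eq (1 - x)), (Rabs_pos_eq (1 + x)) by lra.
    assert (T := Rabs_pos L).
    assert (0 <= Rabs L * (1 - x)) by (apply Rmult_le_pos; lra); nra.
  - rewrite Rabs_mult, (Rabs_pos_eq ((1 - x) ^ 2)) by apply pow2_ge_0.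
    apply Rmult_le_compat_l with (r := (1 - x) ^ 2) in HsE; [|apply pow2_ge_0].
    replace ((1 - x) ^ 2 * (eps / 16 * / (1 - x) ^ 2 + K * / (1 - x)))
      with (eps / 16 + K * (1 - x)) in HsE by (field; lra).
    exact HsE. }
unfold Rdiv at 1; rewrite Rabs_mult, (Rabs_pos_eq (/ x ^ 2))
  by (left; apply Rinv_0_lt_compat; lra).
apply (Rmult_lt_reg_r (x ^ 2)); [lra|].
rewrite Rmult_assoc, Rinv_l, Rmult_1_r by lra.
apply Rlt_div_r in Hx2; [|lra].
assert (T1 : (8 * Rabs L + 4 * K + 1) * (1 - x) < eps / 2) by (fold Q; lra).
assert (T2 : eps / 4 < eps * x ^ 2) by nra.
assert (0 <= Rabs L * (1 - x)) by (apply Rmult_le_pos; [apply Rabs_pos | lra]).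
assert (0 <= K * (1 - x)) by (apply Rmult_le_pos; lra).
lra.
Qed.

End RealAbel.

(** * Complex power series and the binomial series *)

Definition cseries (u : nat -> C) (x : R) (l : C) : Prop :=
  is_series (fun n => Re (u n) * x ^ n)%R (Re l) /\
  is_series (fun n => Im (u n) * x ^ n)%R (Im l).

Lemma cseries_ext u v x l : (forall n, u n = v n) -> cseries u x l -> cseries v x l.
Proof.
intros E [H1 H2]; split; [eapply is_series_ext; [|exact H1] | eapply is_series_ext; [|exact H2]];
  intros n; simpl; rewrite E; reflexivity.
Qed.

Lemma cseries_plus u v x a b :
  cseries u x a -> cseries v x b -> cseries (fun n => u n + v n) x (a + b).
Proof.
intros [H1 H2] [H3 H4]; split.
- eapply is_series_ext; [|apply (is_series_plus _ _ _ _ H1 H3)].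
  intros n; unfold plus; simpl; unfold Re; ring.
- eapply is_series_ext; [|apply (is_series_plus _ _ _ _ H2 H4)].
  intros n; unfold plus; simpl; unfold Im; ring.
Qed.

Lemma cseries_scal c u x a : cseries u x a -> cseries (fun n => c * u n) x (c * a).
Proof.
intros [H1 H2]; split.
- eapply is_series_ext; [|apply (is_series_minus _ _ _ _
    (is_series_scal (Re c) _ _ H1) (is_series_scal (Im c) _ _ H2))].
  intros n; unfold minus, plus, opp, scal; simpl; unfold mult; simpl; unfold Re, Im; ring.
- eapply is_series_ext; [|apply (is_series_plus _ _ _ _
    (is_series_scal (Re c) _ _ H2) (is_series_scal (Im c) _ _ H1))].
  intros n; unfold plus, scal; simpl; unfold mult; simpl; unfold Re, Im; ring.
Qed.

Lemma cseries_unique u x a b : cseries u x a -> cseries u x b -> a = b.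
Proof.
intros [H1 H2] [H3 H4].
apply is_series_unique in H1, H2, H3, H4.
rewrite (surjective_pairing a), (surjective_pairing b).
f_equal; [rewrite H1 in H3 | rewrite H2 in H4]; assumption.
Qed.

(** The coefficient of [x^n] in [(1 + x)^(-alpha)]. *)
Definition bcoef (alpha : C) (n : nat) : C := cpown (-1) n * pdiv alpha n.

Lemma bcoef_S alpha n : RtoC (INR (S n)) * bcoef alpha (S n)
  = - (alpha + RtoC (INR n)) * bcoef alpha n.
Proof.
unfold bcoef; rewrite RtoC_S.
transitivity (cpown (-1) (S n) * ((RtoC (INR n) + 1) * pdiv alpha (S n))); [ring|].
rewrite pdiv_S; simpl; ring.
Qed.

Lemma bcoef_bounded alpha (r : R) : (0 < r < 1)%R ->
  cbounded (fun n => bcoef alpha n * RtoC (r ^ n)).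
Proof.
intros Hr.
assert (H0 : (0 <= Cmod alpha / (/ r - 1))%R).
{ apply Rdiv_le_0_compat; [apply Cmod_ge_0|].
  assert (/ 1 < / r)%R by (apply Rinv_lt_contravar; lra); lra. }
(* Successive terms have ratio [|alpha + n| r / (n+1)] in modulus, at most 1 as soon as
   [|alpha| <= n (1/r - 1)]. *)
destruct (nfloor_ex _ H0) as (N & _ & HN).
assert (Hr1 : (0 < / r - 1)%R)
  by (assert (/ 1 < / r)%R by (apply Rinv_lt_contravar; lra); lra).
set (u := fun n => bcoef alpha n * RtoC (r ^ n)).
assert (Hd : forall n, (S N <= n)%nat -> (Cmod (u (S n)) <= Cmod (u n))%R).
{ intros n Hn; apply le_INR in Hn; rewrite S_INR in Hn.
  apply Rlt_div_l in HN; [|exact Hr1].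
  assert (Hn1 : (0 < INR (S n))%R) by (apply lt_0_INR; lia).
  apply (Rmult_le_reg_l (INR (S n))); [exact Hn1|].
  assert (E : (INR (S n) * Cmod (u (S n)) = Cmod (alpha + RtoC (INR n)) * r * Cmod (u n))%R).
  { rewrite <- (Rabs_pos_eq (INR (S n))) at 1 by lra.
    rewrite <- (Rabs_pos_eq r) at 1 by lra.
    rewrite <- !Cmod_R, <- !Cmod_mult.
    rewrite <- (Cmod_opp (_ * _ * _)); f_equal; unfold u.
    rewrite Cmult_assoc, bcoef_S; simpl pow; rewrite RtoC_mult; ring. }
  rewrite E; apply Rmult_le_compat_r; [apply Cmod_ge_0|].
  assert (T := Cmod_triangle alpha (RtoC (INR n))).
  rewrite Cmod_R, Rabs_pos_eq in T by apply pos_INR.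
  rewrite S_INR.
  assert (T2 : (Cmod alpha <= INR n * (/ r - 1))%R).
  { assert ((INR N + 1) * (/ r - 1) <= INR n * (/ r - 1))%R
      by (apply Rmult_le_compat_r; lra); lra. }
  apply Rle_trans with ((INR n * / r) * r)%R.
  - apply Rmult_le_compat_r; lra.
  - rewrite Rmult_assoc, Rinv_l by lra; lra. }
apply (cbounded_ev _ (Cmod (u (S N))) (S N)).
intros n Hn; induction Hn as [|n Hn IH]; [apply Rle_refl|].
eapply Rle_trans; [apply Hd, Hn | exact IH].
Qed.

Lemma bcoef_radius alpha (x : R) : (Rabs x < 1)%R ->
  Rbar_lt (Rabs x) (CV_radius (fun n => Re (bcoef alpha n))) /\
  Rbar_lt (Rabs x) (CV_radius (fun n => Im (bcoef alpha n))).
Proof.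
intros Hx; assert (H0 := Rabs_pos x).
set (r := ((1 + Rabs x) / 2)%R).
assert (Hr : (0 < r < 1)%R) by (unfold r; lra).
assert (Hxr : (Rabs x < r)%R) by (unfold r; lra).
destruct (bcoef_bounded alpha r Hr) as [K HK].
assert (P : forall n, (0 <= r ^ n)%R) by (intros; apply pow_le; lra).
assert (HK' : forall n, (Cmod (bcoef alpha n) * r ^ n <= K)%R).
{ intros n; specialize (HK n); rewrite Cmod_mult, Cmod_R, Rabs_pos_eq in HK; auto. }
split; (apply Rbar_lt_le_trans with (Finite r); [exact Hxr|]);
  [destruct (CV_radius_bounded (fun n => Re (bcoef alpha n))) as [U _]
  |destruct (CV_radius_bounded (fun n => Im (bcoef alpha n))) as [U _]];
  apply U; exists K; intros n; rewrite Rabs_mult, (Rabs_pos_eq (r ^ n)) by auto;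
  (eapply Rle_trans; [|apply HK']); apply Rmult_le_compat_r; auto.
- apply re_le_Cmod.
- apply im_le_Cmod.
Qed.

Definition bser (alpha : C) (x : R) : C :=
  (PSeries (fun n => Re (bcoef alpha n)) x, PSeries (fun n => Im (bcoef alpha n)) x).

Definition dbser (alpha : C) (x : R) : C :=
  (PSeries (PS_derive (fun n => Re (bcoef alpha n))) x,
   PSeries (PS_derive (fun n => Im (bcoef alpha n))) x).

Lemma cseries_PSeries (a b : nat -> R) (x : R) :
  Rbar_lt (Rabs x) (CV_radius a) -> Rbar_lt (Rabs x) (CV_radius b) ->
  cseries (fun n => (a n, b n)) x (PSeries a x, PSeries b x).
Proof.
intros Ha Hb; split; simpl.
- apply Series_correct, (ex_series_ext (fun n => scal (pow_n x n) (a n))).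
  + intros n; rewrite pow_n_pow; unfold scal; simpl; unfold mult; simpl; ring.
  + apply CV_radius_inside, Ha.
- apply Series_correct, (ex_series_ext (fun n => scal (pow_n x n) (b n))).
  + intros n; rewrite pow_n_pow; unfold scal; simpl; unfold mult; simpl; ring.
  + apply CV_radius_inside, Hb.
Qed.

Lemma cseries_bser alpha x : (Rabs x < 1)%R -> cseries (bcoef alpha) x (bser alpha x).
Proof.
intros Hx; destruct (bcoef_radius alpha x Hx) as [H1 H2].
apply cseries_ext with (2 := cseries_PSeries _ _ x H1 H2).
intros n; symmetry; apply surjective_pairing.
Qed.

Lemma cseries_dbser alpha x : (Rabs x < 1)%R ->
  cseries (fun n => RtoC (INR (S n)) * bcoef alpha (S n)) x (dbser alpha x).
Proof.
intros Hx; destruct (bcoef_radius alpha x Hx) as [H1 H2].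
rewrite <- CV_radius_derive in H1, H2.
apply cseries_ext with (2 := cseries_PSeries _ _ x H1 H2).
intros n; unfold PS_derive; rewrite <- re_scal_l, <- im_scal_l.
symmetry; apply surjective_pairing.
Qed.

(** Passes from the series of [f'] to that of [x f']. *)
Lemma cseries_incr u x l : cseries (fun n => RtoC (INR (S n)) * u (S n)) x l ->
  cseries (fun n => RtoC (INR n) * u n) x (RtoC x * l).
Proof.
intros [H1 H2]; split; rewrite ?re_scal_l, ?im_scal_l.
- apply is_series_decr_1.
  eapply is_series_ext; [|replace (plus _ _) with (scal x (Re l));
    [apply (is_series_scal x _ _ H1)|]].
  + intros n; unfold scal; simpl; unfold mult; simpl; ring.
  + unfold plus, opp, scal; simpl; unfold mult; simpl; unfold Re; simpl; ring.
- apply is_series_decr_1.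
  eapply is_series_ext; [|replace (plus _ _) with (scal x (Im l));
    [apply (is_series_scal x _ _ H2)|]].
  + intros n; unfold scal; simpl; unfold mult; simpl; ring.
  + unfold plus, opp, scal; simpl; unfold mult; simpl; unfold Im; simpl; ring.
Qed.

(** Summing the recurrence [bcoef_S] against [x^n] gives [f' = - alpha f - x f']. *)
Lemma bser_ode alpha x : (Rabs x < 1)%R ->
  (1 + RtoC x) * dbser alpha x = - alpha * bser alpha x.
Proof.
intros Hx.
assert (H1 := cseries_bser alpha x Hx); assert (H2 := cseries_dbser alpha x Hx).
assert (H3 := cseries_incr _ _ _ H2).
assert (E : dbser alpha x = - alpha * bser alpha x + - (1) * (RtoC x * dbser alpha x)).
{ apply cseries_unique with (1 := H2).
  apply cseries_ext with (2 := cseries_plus _ _ _ _ _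
    (cseries_scal (- alpha) _ _ _ H1) (cseries_scal (- (1)) _ _ _ H3)).
  intros n; rewrite bcoef_S; ring. }
transitivity (dbser alpha x + RtoC x * dbser alpha x); [ring|].
rewrite E at 1; ring.
Qed.

(** By [bser_ode] the product has derivative 0 on [[0, 1)], and it is 1 at 0. *)
Lemma binomial_series alpha x : (0 <= x < 1)%R ->
  bser alpha x * cpow_pos (1 + x) alpha = 1.
Proof.
intros Hx.
assert (D : forall y, (0 <= y < 1)%R ->
  is_derive (fun y => Re (bser alpha y * cpow_pos (1 + y) alpha)) y 0%R /\
  is_derive (fun y => Im (bser alpha y * cpow_pos (1 + y) alpha)) y 0%R).
{ intros y Hy.
  assert (Hy1 : (Rabs y < 1)%R) by (rewrite Rabs_pos_eq; lra).
  destruct (bcoef_radius alpha y Hy1) as [R1 R2].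
  assert (G1 := is_derive_PSeries _ _ R1); assert (G2 := is_derive_PSeries _ _ R2).
  destruct (cpow_derive (1 + y) alpha ltac:(lra)) as [P Q].
  assert (A : is_derive (fun x : R => (1 + x)%R) y 1%R) by (auto_derive; auto; ring).
  assert (P' := is_derive_comp (fun s => Re (cpow_pos s alpha)) (fun x : R => (1 + x)%R)
        y _ _ P A); rewrite (scal_one (V := R_NormedModule)) in P'.
  assert (Q' := is_derive_comp (fun s => Im (cpow_pos s alpha)) (fun x : R => (1 + x)%R)
        y _ _ Q A); rewrite (scal_one (V := R_NormedModule)) in Q'.
  clear P Q A.
  assert (O := bser_ode alpha y Hy1).
  assert (E : dbser alpha y * cpow_pos (1 + y) alpha
    + bser alpha y * (alpha * cpow_pos (1 + y) (alpha - 1)) = 0).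
  { replace (cpow_pos (1 + y) alpha) with
      (cpow_pos (1 + y) (alpha - 1) * cpow_pos (1 + y) 1)
      by (rewrite <- cpow_plus; f_equal; ring).
    rewrite cpow_exp1, RtoC_plus by lra.
    transitivity (((1 + RtoC y) * dbser alpha y + alpha * bser alpha y)
      * cpow_pos (1 + y) (alpha - 1)); [ring|]; rewrite O; ring. }
  set (c := fun x => Re (cpow_pos (1 + x) alpha)) in *.
  set (s := fun x => Im (cpow_pos (1 + x) alpha)) in *.
  set (a := PSeries (fun n => Re (bcoef alpha n))) in *.
  set (b := PSeries (fun n => Im (bcoef alpha n))) in *.
  split.
  - apply is_derive_ext with (fun y => (a y * c y - b y * s y)%R); [reflexivity|].
    auto_derive; [repeat split; eexists; eassumption|].
    rewrite (is_derive_unique (fun x : R => a x) _ _ G1),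
      (is_derive_unique (fun x : R => b x) _ _ G2),
      (is_derive_unique (fun x : R => c x) _ _ P'),
      (is_derive_unique (fun x : R => s x) _ _ Q').
    apply (f_equal Re) in E; rewrite re_plus, (re_mult (dbser _ _)), (re_mult (bser _ _)) in E.
    rewrite re_RtoC in E; rewrite <- E.
    unfold c, s, a, b, bser, dbser; simpl; ring.
  - apply is_derive_ext with (fun y => (a y * s y + b y * c y)%R); [reflexivity|].
    auto_derive; [repeat split; eexists; eassumption|].
    rewrite (is_derive_unique (fun x : R => a x) _ _ G1),
      (is_derive_unique (fun x : R => b x) _ _ G2),
      (is_derive_unique (fun x : R => c x) _ _ P'),
      (is_derive_unique (fun x : R => s x) _ _ Q').
    apply (f_equal Im) in E; rewrite im_plus, (im_mult (dbser _ _)), (im_mult (bser _ _)) in E.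
    rewrite im_RtoC in E; rewrite <- E.
    unfold c, s, a, b, bser, dbser; simpl; ring. }
assert (K : forall f : R -> R, (forall y, (0 <= y < 1)%R -> is_derive f y 0%R) ->
  f x = f 0%R).
{ intros f Hf; destruct (MVT_gen f 0 x (fun _ => 0%R)) as (c & _ & E).
  - intros y Hy; rewrite Rmin_left, Rmax_right in Hy by lra; apply Hf; lra.
  - intros y Hy; rewrite Rmin_left, Rmax_right in Hy by lra.
    apply continuity_pt_filterlim, (ex_derive_continuous f).
    eexists; apply Hf; lra.
  - lra. }
assert (V0 : bser alpha 0 * cpow_pos (1 + 0) alpha = 1).
{ rewrite Rplus_0_r, cpow_base1; unfold bser; rewrite !PSeries_0.
  unfold bcoef; rewrite pdiv_0; simpl; unfold Cmult, RtoC; simpl; f_equal; ring. }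
rewrite (surjective_pairing (bser alpha x * cpow_pos (1 + x) alpha)).
rewrite <- V0, (surjective_pairing (bser alpha 0 * cpow_pos (1 + 0) alpha)).
f_equal.
- apply (K (fun y => Re (bser alpha y * cpow_pos (1 + y) alpha))).
  intros y Hy; apply D, Hy.
- apply (K (fun y => Im (bser alpha y * cpow_pos (1 + y) alpha))).
  intros y Hy; apply D, Hy.
Qed.

(** * The double series *)

(** The quotient [(alpha/2 + 1)_n / (alpha/2)_n] telescopes to the linear weight
    [1 + 2 n / alpha]. *)
Lemma kdf_term_term alpha beta a b m n :
  not_npint beta -> not_npint (alpha / 2) ->
  kdf_term [alpha] [a] [b; alpha / 2 + 1] [beta] [] [alpha / 2] (-1) (-1) m n
  = term alpha beta (pdiv a)
      (fun n => pdiv b n * (1 + 2 / alpha * RtoC (INR n))) m n.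
Proof.
intros Hb Ha; unfold kdf_term, term, prodl, pdiv; simpl fold_right.
assert (A0 : alpha / 2 <> 0).
{ intros E; apply (not_npint_plus _ 0 Ha); rewrite E; simpl; ring. }
assert (A1 : alpha <> 0) by (intros E; apply A0; rewrite E; field).
assert (P : poch (alpha / 2 + 1) n
  = poch (alpha / 2) n * (1 + 2 / alpha * RtoC (INR n))).
{ replace (poch (alpha / 2 + 1) n) with (poch (alpha / 2) (S n) / (alpha / 2))
    by (rewrite poch_S_l; field; exact A1).
  simpl; field; exact A1. }
assert (H1 := npint_poch_neq_0 _ n Ha).
assert (H2 := npint_poch_neq_0 _ (m + n) Hb).
assert (H3 := fact_neq_0C m); assert (H4 := fact_neq_0C n).
rewrite P, cpown_plus; field; auto.
Qed.

Lemma kdf_partial_psum alpha beta a b M N :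
  not_npint beta -> not_npint (alpha / 2) ->
  kdf_partial [alpha] [a] [b; alpha / 2 + 1] [beta] [] [alpha / 2] (-1) (-1) M N
  = psum (term alpha beta (pdiv a)
      (fun n => pdiv b n * (1 + 2 / alpha * RtoC (INR n)))) (S M) (S N).
Proof.
intros Hb Ha; unfold kdf_partial, psum; rewrite sum_n_csum.
apply csum_ext; intros m _; rewrite sum_n_csum.
apply csum_ext; intros n _; apply kdf_term_term; assumption.
Qed.

(** Balls of the product structure on [C] are squares, hence [eps / 2] for each coordinate. *)
Lemma pringsheim_Cmod (s : nat -> nat -> C) (L : C) :
  filterlim (fun p : nat * nat => s (fst p) (snd p))
    (filter_prod eventually eventually) (locally L) ->
  forall eps : R, (0 < eps)%R -> exists M N, forall m n,
    (M <= m)%nat -> (N <= n)%nat -> (Cmod (s m n - L) <= eps)%R.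
Proof.
intros H eps He.
assert (He2 : (0 < eps / 2)%R) by lra.
destruct (proj1 (filterlim_locally _ L) H (mkposreal _ He2)) as [P Q [M HM] [N HN] HPQ].
exists M, N; intros m n Hm Hn.
destruct (HPQ m n (HM m Hm) (HN n Hn)) as [B1 B2].
unfold ball in B1, B2; simpl in B1, B2.
unfold AbsRing_ball, abs, minus, plus, opp in B1, B2; simpl in B1, B2.
eapply Rle_trans; [apply Cmod_le_Re_Im|].
rewrite Re_minus, Im_minus; unfold Re, Im; unfold Rminus; lra.
Qed.

(** As [a + b = beta], the convolution produces [(beta)_N], which cancels the denominator. *)
Lemma diag_term alpha beta a b N : not_npint beta -> a + b = beta ->
  diag (term alpha beta (pdiv a)
      (fun n => pdiv b n * (1 + 2 / alpha * RtoC (INR n)))) N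
  = bcoef alpha N * (1 + 2 / alpha * (b / beta) * RtoC (INR N)).
Proof.
intros Hb Hab.
rewrite (diag_ext _ (fun i j => cpown (-1) N * (poch alpha N / poch beta N) *
  (pdiv a i * pdiv b j + 2 / alpha * (pdiv a i * (RtoC (INR j) * pdiv b j)))))
  by (intros i j <-; unfold term; ring).
rewrite diag_scal, (diag_plus (fun i j => pdiv a i * pdiv b j)), diag_scal.
assert (B0 : beta <> 0).
{ intros E; apply (not_npint_plus _ 0 Hb); rewrite E; simpl; ring. }
rewrite vandermonde, vandermonde_weighted by (rewrite Hab; exact B0).
rewrite Hab; unfold bcoef, pdiv, Cdiv.
(* Hiding the inverse keeps [field] from asking for [alpha <> 0], which is not among the
   hypotheses. *)
set (ia := / alpha).
field; repeat split.
- exact B0.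
- apply fact_neq_0C.
- apply npint_poch_neq_0, Hb.
Qed.

Lemma clim_cpow (x : nat -> R) t z : (0 < t)%R -> is_lim_seq x t ->
  clim (fun n => cpow_pos (x n) z) (cpow_pos t z).
Proof.
intros Ht Hx; destruct (cpow_derive t z Ht) as [H1 H2]; split.
- apply (is_lim_seq_continuous (fun s => Re (cpow_pos s z))); [|exact Hx].
  apply continuity_pt_filterlim, (ex_derive_continuous (fun s => Re (cpow_pos s z))).
  eexists; exact H1.
- apply (is_lim_seq_continuous (fun s => Im (cpow_pos s z))); [|exact Hx].
  apply continuity_pt_filterlim, (ex_derive_continuous (fun s => Im (cpow_pos s z))).
  eexists; exact H2.
Qed.

Lemma abel_cesaro_C (t : nat -> nat -> C) (L : C) (F : R -> C) (x : nat -> R) :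
  littleo (fun N => diag (psum t) N - (RtoC (INR N) + 1) * L) ->
  (forall y, (0 < y < 1)%R -> cseries (diag t) y (F y)) ->
  (forall n, (0 < x n < 1)%R) -> is_lim_seq x 1%R ->
  clim (fun n => F (x n)) L.
Proof.
intros HL HF Hx Hl.
(* [p] stands for [Re] and for [Im], so that the real theorem is invoked in one place. *)
assert (G : forall p : C -> R, (forall u v, p (u + v) = (p u + p v)%R) ->
  p 0 = 0%R -> (forall u, (Rabs (p u) <= Cmod u)%R) ->
  (forall u v, p (u - v) = (p u - p v)%R) ->
  (forall (r : R) u, p (RtoC r * u) = (r * p u)%R) ->
  (forall y, (0 < y < 1)%R -> is_series (fun n => p (diag t n) * y ^ n)%R (p (F y))) ->
  is_lim_seq (fun n => p (F (x n))) (p L)).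
{ intros p Hp p0 Hm Hmi Hsc Hs.
  assert (AC := abel_cesaro (fun n => p (diag (psum t) n)) (fun n => p (csum (diag t) n))
    (fun n => p (diag t n)) (p L)).
  apply is_lim_seq_spec; intros eps.
  destruct (AC p0 p0) with (eps := pos eps) as (delta & Hd & h).
  - intros n; rewrite diag_psum_S; apply Hp.
  - intros n; apply Hp.
  - intros e He; destruct (HL e He) as [N hN]; exists N; intros n Hn.
    apply Rle_trans with (2 := hN n Hn).
    rewrite <- Hsc, RtoC_plus, <- Hmi; apply Hm.
  - apply cond_pos.
  - apply is_lim_seq_spec in Hl; destruct (Hl (mkposreal _ Hd)) as [N hN].
    exists N; intros n Hn; specialize (hN n Hn); simpl in hN.
    specialize (Hx n); apply Rabs_lt_between in hN.
    destruct (h (x n) ltac:(lra)) as (s & Hs1 & Hs2).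
    assert (Hs3 := Hs (x n) Hx).
    rewrite <- (is_series_unique _ _ Hs3), (is_series_unique _ _ Hs1); exact Hs2. }
split.
- apply (G Re); try reflexivity.
  + apply re_le_Cmod.
  + apply re_scal_l.
  + intros y Hy; apply HF, Hy.
- apply (G Im); try reflexivity.
  + apply im_le_Cmod.
  + apply im_scal_l.
  + intros y Hy; apply HF, Hy.
Qed.

Lemma pdiv_ratio b n : pdiv b (S n) = pdiv b n * ((b + RtoC (INR n)) / (1 + RtoC (INR n))).
Proof.
replace (pdiv b (S n)) with ((RtoC (INR n) + 1) * pdiv b (S n) / (RtoC (INR n) + 1))
  by (field; apply S_neq_0).
rewrite pdiv_S; field; exact (not_npint_plus _ n not_npint_1).
Qed.

Lemma kdf_value alpha beta a b L :
  not_npint beta -> not_npint (alpha / 2) -> a + b = beta ->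
  kdf_sum_is [alpha] [a] [b; alpha / 2 + 1] [beta] [] [alpha / 2] (-1) (-1) L ->
  L = cpow_pos 2 (- alpha) * (a / beta).
Proof.
intros Hb Ha Hab HL.
assert (B0 : beta <> 0).
{ intros E; apply (not_npint_plus _ 0 Hb); rewrite E; simpl; ring. }
assert (A0 : alpha <> 0).
{ intros E; apply (not_npint_plus _ 0 Ha); rewrite E; simpl; field. }
set (A := pdiv a).
set (B := fun n => pdiv b n * (1 + 2 / alpha * RtoC (INR n))).
set (t := term alpha beta A B).
assert (HP : forall eps : R, (0 < eps)%R -> exists M N, forall m n,
    (M <= m)%nat -> (N <= n)%nat -> (Cmod (psum t m n - L) <= eps)%R).
{ intros eps He.
  destruct (pringsheim_Cmod _ L HL eps He) as (M & N & h).
  (* [kdf_partial] includes its upper indices, [psum] excludes them. *)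
  exists (S M), (S N); intros [|m] [|n] Hm Hn; try lia.
  specialize (h m n ltac:(lia) ltac:(lia)).
  rewrite kdf_partial_psum in h by assumption; exact h. }
assert (HC : corner_bounded (psum t)).
{ destruct (HP 1%R Rlt_0_1) as (M & N & h).
  exists (1 + Cmod L)%R, M, N; intros m n Hm Hn; specialize (h m n Hm Hn).
  assert (T := Cmod_triangle (psum t m n - L) L).
  replace (psum t m n - L + L) with (psum t m n) in T by ring; lra. }
assert (PT : forall m n, psum t m n = psum (term alpha beta B A) n m).
{ intros m n; unfold psum; rewrite csum_exchange.
  apply csum_ext; intros j _; apply csum_ext; intros i _; apply term_sym. }
assert (A1 : A O = 1) by apply pdiv_0.
assert (B1 : B O = 1) by (unfold B; rewrite pdiv_0; simpl; ring).
assert (Hrow : forall m, littleo (fun n => psum t m n)).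
{ apply (row_littleo alpha beta A B (fun n => (b + RtoC (INR n)) / (1 + RtoC (INR n))
    * ((alpha / 2 + 1 + RtoC (INR n)) / (alpha / 2 + RtoC (INR n))))); auto.
  - apply row0_bounded; auto; intros M.
    (* The row weights [pdiv a] are the case [c = 0], where the forbidden equation reads
       [0 = -2]. *)
    destruct (weight_sums_nonzero a 0) with (M := M) as (m & Hm & Hn).
    { intros q E; apply (RtoC_neq_0 2); [lra|].
      replace (RtoC 2) with (- - RtoC 2) by ring; rewrite <- E; ring. }
    exists m; split; [exact Hm|]; intros E; apply Hn, eq_trans with (2 := E).
    apply csum_ext; intros k _; unfold A; ring.
  - intros n; unfold B; rewrite pdiv_ratio, RtoC_S; field.
    assert (H1 := not_npint_plus _ n Ha); assert (H2 := not_npint_plus _ n not_npint_1).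
    repeat split; auto; intros E; apply H1.
    replace (alpha / 2 + RtoC (INR n)) with ((alpha + RtoC (INR n) * 2) / 2) by field.
    rewrite E; field.
  - apply clim_eq with (1 * 1); [|ring]; apply clim_mult; apply clim_shift_ratio.
    + apply not_npint_1.
    + exact Ha. }
assert (Hcol : forall n, littleo (fun m => psum t m n)).
{ intros n; apply littleo_ext with (fun m => psum (term alpha beta B A) n m).
  { intros m; symmetry; apply PT. }
  revert n.
  apply (row_littleo alpha beta B A (fun n => (a + RtoC (INR n)) / (1 + RtoC (INR n)))); auto.
  (* The exceptional case is [alpha = -q]: the sums of the weights [B] may then vanish, but
     [(alpha)_n = 0] beyond [q] bounds the column directly. *)
  - destruct (Classical_Prop.classic (exists q, 2 / alpha * RtoC (INR q) = - (2)))
      as [[q Eq]|Hq].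
    + assert (Eal : alpha = - RtoC (INR q)).
      { replace (RtoC (INR q)) with (2 / alpha * RtoC (INR q) * (alpha / 2))
          by (field; exact A0).
        rewrite Eq; field. }
      apply (cbounded_ev _ 0 (S q)); intros n Hn.
      unfold term; simpl Nat.add; rewrite Eal at 1; rewrite poch_neg_large by lia.
      unfold Cdiv; rewrite Cmult_0_l, Cmult_0_r, Cmult_0_l, Cmod_0; lra.
    + apply row0_bounded; auto.
      * destruct HC as (K & M & N & h); exists K, N, M; intros n m Hn Hm.
        rewrite <- PT; auto.
      * apply weight_sums_nonzero; intros q E; apply Hq; exists q; exact E.
  - intros n; apply pdiv_ratio.
  - apply clim_shift_ratio, not_npint_1. }
assert (HM := antidiagonal_mean _ _ HP Hrow Hcol).
set (c := 2 / alpha * (b / beta)).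
(* This is [f + c y f'] for [f = (1 + y)^(-alpha)], with [f'] replaced by [- alpha f / (1 + y)]. *)
set (F := fun y : R => cpow_pos (1 + y) (- alpha) * (1 - c * alpha * (RtoC y / (1 + RtoC y)))).
assert (HF : forall y, (0 < y < 1)%R -> cseries (diag t) y (F y)).
{ intros y Hy.
  assert (Hy1 : (Rabs y < 1)%R) by (rewrite Rabs_pos_eq; lra).
  assert (Hy2 : 1 + RtoC y <> 0) by (rewrite <- RtoC_plus; apply RtoC_neq_0; lra).
  assert (H1 := cseries_bser alpha y Hy1).
  assert (H2 := cseries_incr _ _ _ (cseries_dbser alpha y Hy1)).
  replace (F y) with (bser alpha y + c * (RtoC y * dbser alpha y)).
  - apply cseries_ext with (2 := cseries_plus _ _ _ _ _ H1 (cseries_scal c _ _ _ H2)).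
    intros n; unfold t, A, B; rewrite diag_term by assumption; fold c; ring.
  - assert (O := bser_ode alpha y Hy1).
    assert (S1 := binomial_series alpha y ltac:(lra)).
    assert (S2 : cpow_pos (1 + y) (- alpha) = bser alpha y).
    { transitivity (bser alpha y * (cpow_pos (1 + y) alpha * cpow_pos (1 + y) (- alpha))).
      - rewrite Cmult_assoc, S1; ring.
      - rewrite <- cpow_plus; replace (alpha + - alpha) with (RtoC 0) by ring.
        rewrite cpow_exp0; ring. }
    unfold F; rewrite S2.
    replace (dbser alpha y) with ((1 + RtoC y) * dbser alpha y / (1 + RtoC y))
      by (field; exact Hy2).
    rewrite O; field; exact Hy2. }
set (x := fun n => (1 - / INR (S (S n)))%R).
assert (Hx : forall n, (0 < x n < 1)%R).
{ intros n; unfold x; rewrite !S_INR; assert (h := pos_INR n).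
  assert (0 < / (INR n + 1 + 1))%R by (apply Rinv_0_lt_compat; lra).
  assert (/ (INR n + 1 + 1) < / 1)%R by (apply Rinv_lt_contravar; lra); lra. }
assert (Hxl : is_lim_seq x 1%R).
{ replace 1%R with (1 - 0)%R by ring.
  apply is_lim_seq_minus'; [apply is_lim_seq_const|].
  apply (is_lim_seq_incr_1 (fun n => (/ INR (S n))%R)).
  apply (is_lim_seq_incr_1 (fun n => (/ INR n)%R)).
  replace (Finite 0) with (Rbar_inv p_infty) by reflexivity.
  apply is_lim_seq_inv; [apply is_lim_seq_INR | discriminate]. }
assert (H1 := abel_cesaro_C t L F x HM HF Hx Hxl).
assert (H2 : clim (fun n => F (x n))
  (cpow_pos 2 (- alpha) * (1 - c * alpha * (/ 2 * 1)))).
{ apply clim_mult.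
  - apply clim_cpow; [lra|].
    replace 2%R with (1 + 1)%R by ring.
    apply is_lim_seq_plus'; [apply is_lim_seq_const | exact Hxl].
  - apply clim_minus; [apply clim_const|].
    apply clim_mult; [apply clim_const|].
    assert (N32 : not_npint (3 / 2)).
    { intros k E; rewrite <- RtoC_div in E by lra; injection E.
      assert (h := pos_INR k); lra. }
    (* At [x = (n+1)/(n+2)] the quotient [x / (1+x)] is [(n+1)/(2n+3)]. *)
    apply clim_ext with (fun n => / 2 * ((1 + RtoC (INR n)) / (3 / 2 + RtoC (INR n)))).
    + intros n; unfold x.
      rewrite RtoC_minus, RtoC_inv by (apply not_0_INR; discriminate).
      assert (K1 := S_neq_0 n); assert (K2 := S_neq_0 (S n)).
      assert (K3 := not_npint_plus _ n N32).
      rewrite !RtoC_S in *; field; repeat split; auto.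
      intros E; apply K3.
        replace (3 / 2 + RtoC (INR n)) with
          ((RtoC (INR n) + 1 + 1 + (RtoC (INR n) + 1 + 1 - 1)) / 2) by field.
        rewrite E; field.
    + apply clim_mult; [apply clim_const | apply clim_shift_ratio, N32]. }
(* Here [c alpha / 2 = b / beta], and [1 - b / beta = a / beta]. *)
rewrite (clim_unique _ _ _ H1 H2); f_equal; unfold c; rewrite <- Hab; field.
split; [rewrite Hab; exact B0 | exact A0].
Qed.

Lemma cpow2_minus2 alpha : cpow_pos 2 (RtoC (-2) - alpha) = cpow_pos 2 (- alpha) / 4.
Proof.
assert (E : cpow_pos 2 1 = 2) by (apply cpow_exp1; lra).
assert (H : cpow_pos 2 (- alpha) = cpow_pos 2 (RtoC (-2) - alpha) * 4).
{ replace (- alpha) with (RtoC (-2) - alpha + (1 + 1)) by ring.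
  rewrite !cpow_plus, E; replace (RtoC 4) with (2 * 2) by ring; ring. }
rewrite H; field.
Qed.

(** * Finite Gamma sums *)

Lemma not_npint_neq_0 z : not_npint z -> z <> 0.
Proof. intros H E; apply (not_npint_plus z 0 H); rewrite E; simpl; ring. Qed.

Lemma CGamma_ratio_2 y : not_npint y -> CGamma y / CGamma (y + 2) = / (y * (y + 1)).
Proof.
intros Hy; replace (y + 2) with (y + 1 + 1) by ring.
rewrite !CGamma_S by auto using not_npint_S.
assert (H1 := not_npint_neq_0 _ Hy).
assert (H2 := not_npint_neq_0 _ (not_npint_S _ Hy)).
assert (H3 := CGamma_neq_0 _ Hy).
field; auto.
Qed.

(** With [v = beta/2 - i - 2] each Gamma quotient is [4 / ((v+r)(v+r+2)) = 2/(v+r) - 2/(v+r+2)], and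
    [inv_shift_bdiff] sums both parts. *)
Lemma CGamma_sum_plus i (beta : C) :
  not_npint (beta / 2) -> not_npint (beta / 2 - RtoC (INR i + 2)) ->
  (forall r, (r <= i)%nat ->
     not_npint (beta / 4 - 1 + RtoC ((INR r - INR i) / 2))) ->
  CGamma (beta / 2) / (RtoC (INR (fact (S i))) * CGamma (beta / 2 - RtoC (INR i + 2)))
  * csum (fun r => cpown (-1) r * RtoC (Binomial.C i r)
      * (CGamma (beta / 4 - 1 + RtoC ((INR r - INR i) / 2))
         / CGamma (beta / 4 + 1 + RtoC ((INR r - INR i) / 2)))) (S i)
  = 4 * ((beta - RtoC (2 + INR i)) / beta).
Proof.
intros Hx Hv Hy.
set (v := beta / 2 - RtoC (INR i + 2)) in *.
assert (Ev : beta = 2 * (v + RtoC (INR i) + 2)) by (unfold v; rewrite RtoC_plus; field).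
(* The numerator Gamma has argument [(v+r)/2]; neither this nor its successor is zero. *)
assert (V : forall r, (r <= i)%nat -> v + RtoC (INR r) <> 0 /\ v + 2 + RtoC (INR r) <> 0).
{ intros r Hr; specialize (Hy r Hr); split; intros E.
  - apply (not_npint_neq_0 _ Hy).
    rewrite RtoC_div, RtoC_minus by lra.
    transitivity ((v + RtoC (INR r)) / 2); [rewrite Ev; field | rewrite E; field].
  - apply (not_npint_neq_0 _ (not_npint_S _ Hy)).
    rewrite RtoC_div, RtoC_minus by lra.
    transitivity ((v + 2 + RtoC (INR r)) / 2); [rewrite Ev; field | rewrite E; field]. }
rewrite (csum_ext _ (fun r => 2 * (RtoC (Binomial.C i r)
    * (fun r => cpown (-1) r / (v + RtoC (INR r))) (0 + r)%nat)
  + - (2) * (RtoC (Binomial.C i r)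
    * (fun r => cpown (-1) r / (v + 2 + RtoC (INR r))) (0 + r)%nat))).
2:{ intros r Hr; destruct (V r ltac:(lia)) as [V1 V2]; specialize (Hy r ltac:(lia)).
    replace (beta / 4 + 1 + RtoC ((INR r - INR i) / 2))
      with (beta / 4 - 1 + RtoC ((INR r - INR i) / 2) + 2) by ring.
    rewrite CGamma_ratio_2 by exact Hy.
    replace (beta / 4 - 1 + RtoC ((INR r - INR i) / 2)) with ((v + RtoC (INR r)) / 2)
      by (rewrite RtoC_div, RtoC_minus, Ev by lra; field).
    replace ((v + RtoC (INR r)) / 2 + 1) with ((v + 2 + RtoC (INR r)) / 2) by field.
    simpl; field; auto. }
rewrite csum_plus, !csum_scal.
rewrite (csum_binomial i (fun r => cpown (-1) r / (v + RtoC (INR r)))).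
rewrite (csum_binomial i (fun r => cpown (-1) r / (v + 2 + RtoC (INR r)))).
rewrite !inv_shift_bdiff by (intros r Hr; apply V, Hr).
assert (EG : CGamma (beta / 2) = poch v (i + 2) * CGamma v).
{ rewrite <- CGamma_poch by exact Hv; f_equal; rewrite Ev, RtoC_INR_plus; simpl INR.
  rewrite RtoC_plus; field. }
assert (G0 := CGamma_neq_0 _ Hv).
rewrite EG; simpl (INR 0); rewrite !Cplus_0_r.
assert (P1 : poch v (i + 2) = poch v (S i) * (v + RtoC (INR i) + 1)).
{ replace (i + 2)%nat with (S (S i)) by lia.
  change (poch v (S (S i))) with (poch v (S i) * (v + RtoC (INR (S i)))).
  rewrite RtoC_S; ring. }
(* Both sides are [(v)_(i+3)]. *)
assert (P2 : poch v (i + 2) * (v + RtoC (INR i) + 2) = v * (v + 1) * poch (v + 2) (S i)).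
{ transitivity (poch v (S (S (S i)))).
  - replace (i + 2)%nat with (S (S i)) by lia.
    change (poch v (S (S (S i)))) with (poch v (S (S i)) * (v + RtoC (INR (S (S i))))).
    rewrite !RtoC_S; ring.
  - rewrite 2!poch_S_l; replace (v + 1 + 1) with (v + 2) by ring; ring. }
assert (N1 : poch v (S i) <> 0).
{ apply poch_neq_0; intros k Hk; apply V; lia. }
assert (N2 : poch (v + 2) (S i) <> 0).
{ apply poch_neq_0; intros k Hk; apply V; lia. }
assert (X0 : v + RtoC (INR i) + 2 <> 0).
{ intros E; apply (not_npint_neq_0 _ Hx); rewrite Ev, E; field. }
assert (F0 := fact_neq_0C i).
assert (F1 := S_neq_0 i).
assert (Q : poch v (i + 2) / poch (v + 2) (S i) = v * (v + 1) / (v + RtoC (INR i) + 2)).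
{ replace (poch v (i + 2)) with
   (poch v (i + 2) * (v + RtoC (INR i) + 2) / (v + RtoC (INR i) + 2)) by (field; exact X0).
  rewrite P2; field; auto. }
rewrite fact_S_C; change (cpown (-1) 0) with (RtoC 1).
transitivity (2 / (RtoC (INR i) + 1)
   * (poch v (i + 2) / poch v (S i) - poch v (i + 2) / poch (v + 2) (S i))).
- field; auto.
(* What remains is [(v+i+1)(v+i+2) - v(v+1) = (i+1)(2v+i+2)], where [2v+i+2 = beta-2-i]. *)
- rewrite Q, P1, Ev, RtoC_plus; field; auto.
Qed.

(** For [i >= 2] the Gamma quotients are rising factorials of length [i - 2]. For [i = 0] and
    [i = 1] that length would be negative: the quotients in the sum are reciprocals and are computed
    directly. *)
Lemma CGamma_sum_minus i (beta : C) :
  not_npint (beta / 2) -> not_npint (beta / 2 + RtoC (INR i - 2)) ->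
  (forall r, (r <= i)%nat ->
     not_npint (beta / 4 - 1 + RtoC ((INR r + INR i) / 2)) /\
     not_npint (beta / 4 + 1 + RtoC ((INR r - INR i) / 2))) ->
  CGamma (beta / 2) / CGamma (beta / 2 + RtoC (INR i - 2))
  * csum (fun r => RtoC (Binomial.C i r)
      * (CGamma (beta / 4 - 1 + RtoC ((INR r + INR i) / 2))
         / CGamma (beta / 4 + 1 + RtoC ((INR r - INR i) / 2)))) (S i)
  = 4 * ((beta - 2 + RtoC (INR i)) / beta).
Proof.
intros Hx Hv Hy.
set (x := beta / 2) in *.
assert (X0 := not_npint_neq_0 _ Hx).
assert (Eb : beta = 2 * x) by (unfold x; field).
assert (G0 := CGamma_neq_0 _ Hx).
destruct i as [|[|k]].
- destruct (Hy O (le_n _)) as [Y _]; revert Hv Y; cbn [csum]; simpl INR; intros Hv Y.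
  rewrite C_n_0.
  replace (RtoC ((0 + 0) / 2)) with (RtoC 0) in * by (f_equal; field).
  replace (RtoC ((0 - 0) / 2)) with (RtoC 0) by (f_equal; field).
  rewrite Cplus_0_r in *.
  replace (beta / 4 + 1 + 0) with (beta / 4 - 1 + 2) by ring.
  rewrite CGamma_ratio_2 by exact Y.
  set (z := x + RtoC (0 - 2)) in *.
  assert (Ez : x = z + 1 + 1) by (unfold z; rewrite RtoC_minus; ring).
  rewrite Ez at 1; rewrite !CGamma_S by auto using not_npint_S.
  assert (G1 := CGamma_neq_0 _ Hv).
  assert (Y0 := not_npint_neq_0 _ Y); assert (Y1 := not_npint_neq_0 _ (not_npint_S _ Y)).
  assert (Z0 := not_npint_neq_0 _ Hv).
  revert Y0 Y1; replace (beta / 4 - 1) with (z / 2) by (rewrite Eb, Ez; field).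
  replace (z / 2 + 1) with (x / 2) by (rewrite Ez; field); intros Y0 Y1.
  rewrite Eb; replace z with (x - 1 - 1) in * by (rewrite Ez; ring).
  field; auto.
- destruct (Hy O ltac:(lia)) as [Ya _]; destruct (Hy 1%nat ltac:(lia)) as [Yb _].
  revert Hv Ya Yb; cbn [csum]; simpl INR; intros Hv Ya Yb.
  rewrite C_n_0, C_n_n.
  replace (RtoC (1 - 2)) with (- (1)) in * by (rewrite RtoC_minus; ring).
  replace (RtoC ((0 - 1) / 2)) with (RtoC ((0 + 1) / 2) - 1)
    by (rewrite <- RtoC_minus; f_equal; field).
  replace (RtoC ((1 - 1) / 2)) with (RtoC ((1 + 1) / 2) - 1)
    by (rewrite <- RtoC_minus; f_equal; field).
  set (p := beta / 4 - 1 + RtoC ((0 + 1) / 2)) in *.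
  set (q := beta / 4 - 1 + RtoC ((1 + 1) / 2)) in *.
  replace (beta / 4 + 1 + (RtoC ((0 + 1) / 2) - 1)) with (p + 1) by (unfold p; ring).
  replace (beta / 4 + 1 + (RtoC ((1 + 1) / 2) - 1)) with (q + 1) by (unfold q; ring).
  replace (CGamma x) with (CGamma (x + - (1) + 1)) by (f_equal; ring).
  rewrite !CGamma_S by assumption.
  assert (G1 := CGamma_neq_0 _ Hv); assert (Z0 := not_npint_neq_0 _ Hv).
  assert (Gp := CGamma_neq_0 _ Ya); assert (P0 := not_npint_neq_0 _ Ya).
  assert (Gq := CGamma_neq_0 _ Yb).
  transitivity ((x - 1) * (/ p + / q)).
  { assert (Q0 := not_npint_neq_0 _ Yb); field; auto. }
  replace q with (x / 2)
    by (unfold q; rewrite RtoC_div, RtoC_plus, Eb by lra; field).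
  revert P0; replace p with ((x - 1) / 2)
    by (unfold p; rewrite RtoC_div, RtoC_plus, Eb by lra; field); intros P0.
  rewrite Eb; field; repeat split; auto.
- rewrite (csum_ext _ (fun r => RtoC (Binomial.C (S (S k)) r) * halfpoch x k (0 + r)%nat)).
  2:{ intros r Hr; destruct (Hy r ltac:(lia)) as [_ Y].
      set (y := beta / 4 + 1 + RtoC ((INR r - INR (S (S k))) / 2)) in *.
      assert (Ey : y = (x + RtoC (INR r) - RtoC (INR k)) / 2).
      { unfold y; rewrite RtoC_div, RtoC_minus, !RtoC_S, Eb by lra; field. }
      replace (beta / 4 - 1 + RtoC ((INR r + INR (S (S k))) / 2)) with (y + RtoC (INR k)).
      2:{ rewrite Ey, RtoC_div, RtoC_plus, !RtoC_S, Eb by lra; field. }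
      rewrite CGamma_poch by exact Y.
      unfold halfpoch; simpl Nat.add; rewrite <- Ey; field.
      apply CGamma_neq_0, Y. }
  rewrite csum_binomial.
  (* [bdiff_halfpoch] consumes [k + 1] of the [i = k + 2] factors [1 + E]; the remaining one leaves
     the values at 0 and 1. *)
  change (bdiff (S (S k)) (halfpoch x k) 0)
    with (bdiff (S k) (halfpoch x k) 0 + bdiff (S k) (halfpoch x k) 1).
  rewrite !bdiff_halfpoch.
  replace (x + RtoC (INR (S (S k)) - 2)) with (x + RtoC (INR k))
    by (rewrite RtoC_minus, !RtoC_S; ring).
  rewrite CGamma_poch by exact Hx.
  change (INR 1) with 1%R; change (INR 0) with 0%R; rewrite Cplus_0_r.
  assert (P0 := npint_poch_neq_0 x k Hx).
  (* The two values then add up to [2 (x)_k (2x + k) / x], with [2x + k = beta - 2 + i]. *)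
  replace (poch (x + 1) k) with (poch x k * (x + RtoC (INR k)) / x).
  2:{ change (poch x k * (x + RtoC (INR k))) with (poch x (S k)); rewrite poch_S_l.
      field; exact X0. }
  rewrite Eb, !RtoC_S; field; auto.
Qed.

Local Close Scope C_scope.

Theorem theorem3 (i : nat) (alpha beta : C)
  (Hbeta : not_npint beta) (Halpha : not_npint (Cdiv alpha (RtoC 2))) :
  (forall L : C,
     kdf_sum_is [alpha] [Cminus beta (RtoC (2 + INR i))]
                [RtoC (2 + INR i); Cplus (Cdiv alpha (RtoC 2)) (RtoC 1)]
                [beta] [] [Cdiv alpha (RtoC 2)] (RtoC (-1)) (RtoC (-1)) L ->
     not_npint (Cdiv beta (RtoC 2)) ->
     not_npint (Cminus (Cdiv beta (RtoC 2)) (RtoC (INR i + 2))) ->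
     (forall r : nat, (r <= i)%nat ->
        not_npint (Cplus (Cminus (Cdiv beta (RtoC 4)) (RtoC 1))
                         (RtoC ((INR r - INR i) / 2))) /\
        not_npint (Cplus (Cplus (Cdiv beta (RtoC 4)) (RtoC 1))
                         (RtoC ((INR r - INR i) / 2)))) ->
     L = Cmult
           (Cdiv (Cmult (cpow_pos 2 (Cminus (RtoC (-2)) alpha))
                        (CGamma (Cdiv beta (RtoC 2))))
                 (Cmult (RtoC (INR (fact (S i))))
                        (CGamma (Cminus (Cdiv beta (RtoC 2)) (RtoC (INR i + 2))))))
           (sum_n (fun r =>
              Cmult (Cmult (cpown (RtoC (-1)) r) (RtoC (Binomial.C i r)))
                    (Cdiv (CGamma (Cplus (Cminus (Cdiv beta (RtoC 4)) (RtoC 1))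
                                         (RtoC ((INR r - INR i) / 2))))
                          (CGamma (Cplus (Cplus (Cdiv beta (RtoC 4)) (RtoC 1))
                                         (RtoC ((INR r - INR i) / 2)))))) i))
  /\
  (forall L : C,
     kdf_sum_is [alpha] [Cplus (Cminus beta (RtoC 2)) (RtoC (INR i))]
                [RtoC (2 - INR i); Cplus (Cdiv alpha (RtoC 2)) (RtoC 1)]
                [beta] [] [Cdiv alpha (RtoC 2)] (RtoC (-1)) (RtoC (-1)) L ->
     not_npint (Cdiv beta (RtoC 2)) ->
     not_npint (Cplus (Cdiv beta (RtoC 2)) (RtoC (INR i - 2))) ->
     (forall r : nat, (r <= i)%nat ->
        not_npint (Cplus (Cminus (Cdiv beta (RtoC 4)) (RtoC 1))
                         (RtoC ((INR r + INR i) / 2))) /\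
        not_npint (Cplus (Cplus (Cdiv beta (RtoC 4)) (RtoC 1))
                         (RtoC ((INR r - INR i) / 2)))) ->
     L = Cmult
           (Cdiv (Cmult (cpow_pos 2 (Cminus (RtoC (-2)) alpha))
                        (CGamma (Cdiv beta (RtoC 2))))
                 (CGamma (Cplus (Cdiv beta (RtoC 2)) (RtoC (INR i - 2)))))
           (sum_n (fun r =>
              Cmult (RtoC (Binomial.C i r))
                    (Cdiv (CGamma (Cplus (Cminus (Cdiv beta (RtoC 4)) (RtoC 1))
                                         (RtoC ((INR r + INR i) / 2))))
                          (CGamma (Cplus (Cplus (Cdiv beta (RtoC 4)) (RtoC 1))
                                         (RtoC ((INR r - INR i) / 2)))))) i)).
Proof.
assert (B0 : beta <> RtoC 0) by apply (not_npint_neq_0 _ Hbeta).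
split.
- intros L HL Hx Hv Hy.
  apply kdf_value in HL; [|assumption..|ring]; rewrite HL.
  rewrite sum_n_csum, cpow2_minus2.
  assert (E := CGamma_sum_plus i beta Hx Hv (fun r Hr => proj1 (Hy r Hr))).
  unfold Cdiv in E |- *; rewrite <- !Cmult_assoc.
  rewrite <- !Cmult_assoc in E; rewrite E; field; exact B0.
- intros L HL Hx Hv Hy.
  apply kdf_value in HL; [|assumption..|rewrite RtoC_minus; ring]; rewrite HL.
  rewrite sum_n_csum, cpow2_minus2.
  assert (E := CGamma_sum_minus i beta Hx Hv Hy).
  unfold Cdiv in E |- *; rewrite <- !Cmult_assoc.
  rewrite <- !Cmult_assoc in E; rewrite E; field; exact B0.
Qed.
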